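(* Let $\alpha\ge 0$ and $0\le\beta<1$, and let $f=h+\overline{g}\in\mathcal{W}_{\mathcal H}^{0}(\alpha,\beta)$ be given by $f(z)=z+\sum_{n=2}^{\infty}a_nz^n+\overline{\sum_{n=2}^{\infty}b_nz^n}$. Let $\{\varphi_n(r)\}_{n\ge 0}$ be a sequence of nonnegative increasing functions on $[0,1)$, differentiable in $(0,1)$, such that the series $\sum_{n=0}^{\infty}\varphi_n(r)$ converges locally uniformly with respect to $r\in[0,1)$, and $$\sum_{n=2}^{\infty}\frac{\varphi_n(0)}{n\bigl(1+\alpha(n-1)\bigr)}<\frac{1}{2(1-\beta)}+\sum_{n=2}^{\infty}\frac{(-1)^{n-1}}{\alpha n^{2}+n(1-\alpha)} .$$ Then the inequality $$r\varphi_0(r)+\sum_{n=2}^{\infty}\bigl(|a_n|+|b_n|\bigr)\varphi_n(r)\le d\bigl(f(0),\partial f(\mathbb{D})\bigr)$$ holds for all $|z|=r\le r_f(\alpha,\beta)$, where $r_f(\alpha,\beta)$ is the unique root in $(0,1)$ of the equation $$r\varphi_0(r)+2(1-\beta)\sum_{n=2}^{\infty}\frac{\varphi_n(r)}{n\bigl(1+\alpha(n-1)\bigr)}=1+2\sum_{n=2}^{\infty}\frac{(-1)^{n-1}(1-\beta)}{\alpha n^{2}+n(1-\alpha)} .$$ The radius $r_f(\alpha,\beta)$ is best possible.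
   Context: $\mathbb{D}=\{z\in\mathbb{C}:|z|<1\}$. $\mathcal{H}_0$ is the class of complex-valued harmonic functions $f=h+\overline{g}$ in $\mathbb{D}$, with $h,g$ analytic in $\mathbb{D}$, normalized by $h(0)=h'(0)-1=0$ and $g(0)=g'(0)=0$; every such $f$ has the form $f(z)=z+\sum_{n=2}^{\infty}a_nz^n+\overline{\sum_{n=2}^{\infty}b_nz^n}$. For $\alpha\ge0$ and $0\le\beta<1$, $$\mathcal{W}_{\mathcal H}^{0}(\alpha,\beta)=\{f=h+\overline{g}\in\mathcal{H}_0:\operatorname{Re}\bigl(h'(z)+\alpha zh''(z)-\beta\bigr)>|g'(z)+\alpha zg''(z)|\ \text{for all } z\in\mathbb{D}\}.$$ $d(f(0),\partial f(\mathbb{D}))$ denotes the Euclidean distance between $f(0)$ and the boundary of $f(\mathbb{D})$, which is taken to be given by $d(f(0),\partial f(\mathbb{D}))=\liminf_{|z|\to1}|f(z)-f(0)|$. ''Best possible'' means that $r_f(\alpha,\beta)$ cannot be replaced by any larger number with the inequality still holding for all $f\in\mathcal{W}_{\mathcal H}^{0}(\alpha,\beta)$ and all $r$ up to that number.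
   Formalization: A root need not exist (φ_n = 0) or be unique. Existence is proved if φ_n (n≥2) is right-continuous at 0 and the left side reaches the right side in (0,1); uniqueness if φ_0>0 on (0,1) or some φ_n (n≥2) is strictly increasing. The inequality holds for any root, sharpness for a unique one. *)

(* Defs.v *)
From Stdlib Require Import Reals.
From Coquelicot Require Import Coquelicot.
Open Scope R_scope.

Definition unit_disk (z : C) : Prop := Cmod z < 1.

Definition analytic_in_disk (h : C -> C) : Prop :=
  forall z : C, unit_disk z -> ex_derive h z.

(* [f = h + conj g] on the disk, with [h], [g] analytic and normalized. *)
Definition H0_decomposition (f h g : C -> C) : Prop :=
  analytic_in_disk h /\ analytic_in_disk g /\
  (forall z : C, unit_disk z -> f z = (h z + Cconj (g z))%C) /\
  h 0%C = 0%C /\ C_derive h 0%C = 1%C /\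
  g 0%C = 0%C /\ C_derive g 0%C = 0%C.

(* [C_derive] is a total operator; for a function analytic in the disk it is
   the complex derivative there ([C_derive_correct]), and so is its iterate. *)
Definition W0H (alpha beta : R) (f : C -> C) : Prop :=
  exists h g : C -> C,
    H0_decomposition f h g /\
    forall z : C, unit_disk z ->
      Re (C_derive h z + alpha * z * C_derive (C_derive h) z - beta)%C
      > Cmod (C_derive g z + alpha * z * C_derive (C_derive g) z)%C.

(* [f z = z + sum_(n >= 2) a_n z^n + conj (sum_(n >= 2) b_n z^n)] on the disk;
   the values of [a] and [b] at 0 and 1 play no role. *)
Definition has_coefficients (f : C -> C) (a b : nat -> C) : Prop :=
  forall z : C, unit_disk z -> exists A B : C,
    is_series (fun k : nat => (a (k + 2)%nat * z ^ (k + 2))%C) A /\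
    is_series (fun k : nat => (b (k + 2)%nat * z ^ (k + 2))%C) B /\
    f z = (z + A + Cconj B)%C.

(* [liminf_(|z| -> 1) |f z - f 0|], as the supremum over [rho < 1] of the
   infimum over the annulus [rho < |z| < 1]; these infima are finite, being
   taken over nonempty sets of nonnegative reals. *)
Definition boundary_dist (f : C -> C) : Rbar :=
  Lub_Rbar (fun m : R => exists rho : R, 0 <= rho < 1 /\
    Glb_Rbar (fun x : R => exists z : C,
      rho < Cmod z < 1 /\ x = Cmod (f z - f 0%C)%C) = Finite m).

(* [sum_(n >= 2) u n] *)
Definition Series2 (u : nat -> R) : R := Series (fun k : nat => u (k + 2)%nat).

Definition nondecreasing_on_01 (p : R -> R) : Prop :=
  forall x y : R, 0 <= x -> x <= y -> y < 1 -> p x <= p y.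

Definition strictly_increasing_on_01 (p : R -> R) : Prop :=
  forall x y : R, 0 <= x -> x < y -> y < 1 -> p x < p y.

(* [CVU_dom] is uniform convergence on a domain: every point of [0,1) has a
   relative neighbourhood on which the partial sums converge uniformly. *)
Definition series_cv_locally_uniformly (phi : nat -> R -> R) : Prop :=
  forall r : R, 0 <= r < 1 -> exists d : posreal,
    CVU_dom (fun N s => sum_n (fun n => phi n s) N)
            (fun s => 0 <= s < 1 /\ Rabs (s - r) < d).

Definition admissible (phi : nat -> R -> R) : Prop :=
  (forall (n : nat) (r : R), 0 <= r < 1 -> 0 <= phi n r) /\
  (forall n : nat, nondecreasing_on_01 (phi n)) /\
  (forall (n : nat) (r : R), 0 < r < 1 -> ex_derive (phi n) r) /\
  series_cv_locally_uniformly phi.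

Definition radius_lhs (alpha beta : R) (phi : nat -> R -> R) (r : R) : R :=
  r * phi 0%nat r
  + 2 * (1 - beta) *
    Series2 (fun n => phi n r / (INR n * (1 + alpha * (INR n - 1)))).

Definition radius_rhs (alpha beta : R) : R :=
  1 + 2 * Series2 (fun n => (-1) ^ (n - 1) * (1 - beta)
                            / (alpha * INR n ^ 2 + INR n * (1 - alpha))).

Definition radius_root (alpha beta : R) (phi : nat -> R -> R) (r : R) : Prop :=
  0 < r < 1 /\ radius_lhs alpha beta phi r = radius_rhs alpha beta.

Definition bohr_inequality
    (phi : nat -> R -> R) (f : C -> C) (a b : nat -> C) (r : R) : Prop :=
  Rbar_le
    (Finite (r * phi 0%nat r
             + Series2 (fun n => (Cmod (a n) + Cmod (b n)) * phi n r)))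
    (boundary_dist f).

(* Main.v *)
Require Import Defs.
From Stdlib Require Import Reals Lra Lia Psatz.
From Coquelicot Require Import Coquelicot.
Open Scope R_scope.

(* Write [D_n = n (1 + alpha (n - 1))]. Since [h - z - A = Cconj (B - g)] is both analytic and
   anti-analytic, [h] and [g] are the given power series. For [|e| = 1] the function
   [P = F' + alpha z F'' - beta] with [F = h + e g] has positive real part, value [1 - beta]
   at [0], and coefficients [D_(m+1) (a_(m+1) + e b_(m+1))]. Averaging [Re P] against
   nonnegative trigonometric kernels over roots of unity gives Caratheodory's bound
   [D_n (|a_n| + |b_n|) <= 2 (1 - beta)] and Harnack's inequality.

   Dividing the coefficients of a power series in [t] by [1 + gamma m] preserves nonnegativity
   on [[0, 1)]; doing so for [gamma = alpha] and [gamma = 1] turns Harnack's inequality into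
   [Re (F z / z) >= 1 + 2 (1 - beta) sum_(n >= 2) (-1)^(n-1) |z|^(n-1) / D_n]. With [e]
   such that [e g z = Cconj (g z)] one has [f z = F z], so no univalence is needed; Abel's
   theorem then yields the lower bound of the boundary distance. The function
   [z + sum_(n >= 2) 2 (1 - beta) z^n / D_n], evaluated at [z = - r], shows sharpness. *)

(** Since [D_(m+1) = (1 + m) (1 + alpha m)], passing from [P] back to [F z / z] amounts to two
    successive divisions of the coefficients, one for each [gamma]. Roots of unity replace
    integration over the circle: [2 M + 1] of them average a product of two polynomials of degree at
    most [M] exactly, and absolute summability controls the truncation. The kernel [1 - Cconj e z^n]
    gives the coefficient bound; the Poisson kernel minus its minimum gives Harnack's inequality.
    The obstacle is that positivity is known only in the open disk, whereas the averages need it on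
    the circle, so [P] is first dilated by some [rho < 1]. For a coefficient, [rho] then tends to 1.
    For the growth at [z], one takes [rho = sqrt |z|] and evaluates at a point of the same modulus;
    this puts a square root into the estimate but keeps its limit as [|z|] tends to 1. *)

(** * Absolutely convergent complex series *)

(* [sum_n] and [is_series] produce equations in the carriers of [C] and [R] seen as abstract
   structures, which [ring] does not recognize. *)
Ltac cring := match goal with |- ?a = ?b => change (@eq C a b) end; ring.
Ltac rring := match goal with |- ?a = ?b => change (@eq R a b) end; ring.

Lemma is_series_zero : is_series (fun _ : nat => 0) 0.
Proof.
  intros P [eps HP]. exists 0%nat; intros N _. rewrite sum_n_const. apply HP.
  replace (INR (S N) * 0) with 0 by ring. apply ball_center.
Qed.

(** Total, like [Series]: it is the sum whenever the series converges, and carries no meaning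
    otherwise. *)
Definition CSeries (u : nat -> C) : C :=
  (Series (fun n => Re (u n)), Series (fun n => Im (u n))).

Definition abs_summable (u : nat -> C) : Prop := ex_series (fun n => Cmod (u n)).

Lemma Re_sum_n (u : nat -> C) (N : nat) :
  Re (sum_n u N) = sum_n (fun n => Re (u n)) N.
Proof.
  induction N as [|N IH]; [now rewrite !sum_O|].
  now rewrite !sum_Sn, <- IH.
Qed.

Lemma Im_sum_n (u : nat -> C) (N : nat) :
  Im (sum_n u N) = sum_n (fun n => Im (u n)) N.
Proof.
  induction N as [|N IH]; [now rewrite !sum_O|].
  now rewrite !sum_Sn, <- IH.
Qed.

Lemma im_le_Cmod (z : C) : Rabs (Im z) <= Cmod z.
Proof.
  eapply Rle_trans; [apply Rmax_r|apply (Rmax_Cmod z)].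
Qed.

Lemma Cmod_le_Re_Im (z : C) : Cmod z <= Rabs (Re z) + Rabs (Im z).
Proof.
  assert (Hz : z = (RtoC (Re z) + Ci * RtoC (Im z))%C).
  { destruct z as [x y]; unfold Re, Im, Ci, RtoC, Cplus, Cmult; simpl; f_equal; ring. }
  rewrite Hz at 1. eapply Rle_trans; [apply Cmod_triangle|].
  rewrite Cmod_mult, Cmod_Ci, !Cmod_R. lra.
Qed.

Lemma is_series_Re (u : nat -> C) (l : C) :
  is_series u l -> is_series (fun n => Re (u n)) (Re l).
Proof.
  intros H P [eps HP].
  destruct (H (fun z => P (Re z))) as [N HN].
  { exists eps; intros z [Hz _]; now apply HP. }
  exists N; intros n Hn. rewrite <- Re_sum_n. now apply HN.
Qed.

Lemma is_series_Im (u : nat -> C) (l : C) :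
  is_series u l -> is_series (fun n => Im (u n)) (Im l).
Proof.
  intros H P [eps HP].
  destruct (H (fun z => P (Im z))) as [N HN].
  { exists eps; intros z [_ Hz]; now apply HP. }
  exists N; intros n Hn. rewrite <- Im_sum_n. now apply HN.
Qed.

Lemma is_series_pair (u : nat -> C) (l : C) :
  is_series (fun n => Re (u n)) (Re l) -> is_series (fun n => Im (u n)) (Im l) ->
  is_series u l.
Proof.
  intros H1 H2 P [eps HP].
  destruct (H1 (ball (Re l) eps)) as [N1 HN1]; [now exists eps|].
  destruct (H2 (ball (Im l) eps)) as [N2 HN2]; [now exists eps|].
  exists (N1 + N2)%nat; intros n Hn. apply HP; split.
  - change (ball (Re l) eps (Re (sum_n u n))). rewrite Re_sum_n. apply HN1; lia.
  - change (ball (Im l) eps (Im (sum_n u n))). rewrite Im_sum_n. apply HN2; lia.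
Qed.

Lemma is_series_CSeries (u : nat -> C) (l : C) : is_series u l -> CSeries u = l.
Proof.
  intros H. unfold CSeries.
  rewrite (is_series_unique _ _ (is_series_Re _ _ H)).
  rewrite (is_series_unique _ _ (is_series_Im _ _ H)).
  now destruct l.
Qed.

Lemma abs_summable_Re (u : nat -> C) : abs_summable u -> ex_series (fun n => Re (u n)).
Proof.
  intros H; apply ex_series_Rabs.
  apply (ex_series_le (V := R_CompleteNormedModule) _ (fun n => Cmod (u n))); [|exact H].
  intros n; unfold norm; simpl. rewrite Rabs_Rabsolu. apply re_le_Cmod.
Qed.

Lemma abs_summable_Im (u : nat -> C) : abs_summable u -> ex_series (fun n => Im (u n)).
Proof.
  intros H; apply ex_series_Rabs.
  apply (ex_series_le (V := R_CompleteNormedModule) _ (fun n => Cmod (u n))); [|exact H].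
  intros n; unfold norm; simpl. rewrite Rabs_Rabsolu. apply im_le_Cmod.
Qed.

Lemma abs_summable_is_series (u : nat -> C) : abs_summable u -> is_series u (CSeries u).
Proof.
  intros H; apply is_series_pair; apply Series_correct;
    [now apply abs_summable_Re|now apply abs_summable_Im].
Qed.

Lemma CSeries_ext (u v : nat -> C) : (forall n, u n = v n) -> CSeries u = CSeries v.
Proof.
  intros H; unfold CSeries; f_equal; apply Series_ext; intros n; now rewrite H.
Qed.

Lemma abs_summable_ext (u v : nat -> C) :
  (forall n, u n = v n) -> abs_summable u -> abs_summable v.
Proof.
  intros H; apply ex_series_ext; intros n; now rewrite H.
Qed.

Lemma abs_summable_le (u : nat -> C) (x : nat -> R) :
  (forall n, Cmod (u n) <= x n) -> ex_series x -> abs_summable u.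
Proof.
  intros H Hx. apply (ex_series_le (V := R_CompleteNormedModule) _ x); [|exact Hx].
  intros n; unfold norm; simpl. unfold abs; simpl.
  rewrite Rabs_pos_eq by apply Cmod_ge_0. apply H.
Qed.

Lemma abs_summable_plus (u v : nat -> C) :
  abs_summable u -> abs_summable v -> abs_summable (fun n => (u n + v n)%C).
Proof.
  intros Hu Hv. apply (abs_summable_le _ (fun n => Cmod (u n) + Cmod (v n))).
  - intros n; apply Cmod_triangle.
  - now apply (ex_series_plus (fun n => Cmod (u n)) (fun n => Cmod (v n))).
Qed.

Lemma abs_summable_scal (c : C) (u : nat -> C) :
  abs_summable u -> abs_summable (fun n => (c * u n)%C).
Proof.
  intros Hu. apply (abs_summable_le _ (fun n => Cmod c * Cmod (u n))).
  - intros n; rewrite Cmod_mult; lra.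
  - now apply (ex_series_scal_l (Cmod c) (fun n => Cmod (u n))).
Qed.

Lemma CSeries_plus (u v : nat -> C) :
  abs_summable u -> abs_summable v ->
  CSeries (fun n => (u n + v n)%C) = (CSeries u + CSeries v)%C.
Proof.
  intros Hu Hv. apply is_series_CSeries.
  apply (is_series_plus u v); now apply abs_summable_is_series.
Qed.

Lemma CSeries_scal (c : C) (u : nat -> C) :
  abs_summable u -> CSeries (fun n => (c * u n)%C) = (c * CSeries u)%C.
Proof.
  intros Hu. apply is_series_CSeries.
  apply (is_series_scal c u). now apply abs_summable_is_series.
Qed.

Lemma abs_summable_incr (u : nat -> C) :
  abs_summable u <-> abs_summable (fun n => u (S n)).
Proof.
  exact (ex_series_incr_1 (fun n => Cmod (u n))).
Qed.

Lemma CSeries_incr (u : nat -> C) :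
  abs_summable u -> CSeries u = (u 0%nat + CSeries (fun n => u (S n)))%C.
Proof.
  intros Hu. unfold CSeries.
  rewrite (Series_incr_1 (fun n => Re (u n))) by now apply abs_summable_Re.
  rewrite (Series_incr_1 (fun n => Im (u n))) by now apply abs_summable_Im.
  reflexivity.
Qed.

Lemma Cmod_sum_n (u : nat -> C) (N : nat) :
  Cmod (sum_n u N) <= sum_n (fun n => Cmod (u n)) N.
Proof.
  induction N as [|N IH]; [rewrite !sum_O; lra|].
  rewrite !sum_Sn. eapply Rle_trans; [apply Cmod_triangle|].
  unfold plus; simpl; lra.
Qed.

Lemma is_series_eps (u : nat -> R) (l eps : R) :
  is_series u l -> 0 < eps ->
  exists N, forall n, (N <= n)%nat -> Rabs (sum_n u n - l) < eps.
Proof.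
  intros H He.
  destruct (H (ball l (mkposreal eps He))) as [N HN]; [now exists (mkposreal eps He)|].
  exists N; exact HN.
Qed.

Lemma sum_n_le_Series (x : nat -> R) (N : nat) :
  (forall n, 0 <= x n) -> ex_series x -> sum_n x N <= Series x.
Proof.
  intros Hx Hs.
  rewrite (Series_incr_n x (S N)) by (trivial; lia). simpl pred.
  rewrite sum_n_Reals.
  assert (0 <= Series (fun k => x (S N + k)%nat)); [|lra].
  rewrite <- (Rmult_0_l (Series (fun _ => 0))), <- Series_scal_l.
  apply Series_le; [intros n; rewrite Rmult_0_l; split; [lra|apply Hx]|].
  now apply (ex_series_incr_n x (S N)).
Qed.

Lemma is_series_le_bound (x : nat -> R) (l M : R) :
  is_series x l -> (forall N, sum_n x N <= M) -> l <= M.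
Proof.
  intros H HM. destruct (Rle_or_lt l M) as [|Hlt]; [assumption|].
  destruct (is_series_eps x l (l - M) H) as [N HN]; [lra|].
  specialize (HN N (Nat.le_refl _)). specialize (HM N).
  apply Rabs_def2 in HN. lra.
Qed.

(** The modulus is attained as the real part of a rotation, with [e = Cconj z / Cmod z]. This
    reduces complex bounds to real ones. *)
Lemma Cmod_le_of_directions (z : C) (M : R) : 0 <= M ->
  (forall e : C, Cmod e = 1 -> Re (e * z)%C <= M) -> Cmod z <= M.
Proof.
  intros HM H.
  destruct (Req_dec (Cmod z) 0) as [H0|H0]; [lra|].
  assert (Hz : z <> 0%C) by (intros ->; now rewrite Cmod_0 in H0).
  specialize (H (Cconj z / Cmod z)%C).
  assert (Hc : RtoC (Cmod z) <> 0%C) by (intros E; apply H0; now apply RtoC_inj).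
  assert (E : (Cconj z / Cmod z * z)%C = RtoC (Cmod z)).
  { replace (Cconj z / Cmod z * z)%C with ((z * Cconj z) / Cmod z)%C by (field; exact Hc).
    rewrite <- Cmod2_conj, RtoC_pow. field. exact Hc. }
  rewrite E in H. apply H.
  rewrite Cmod_div, Cmod_conj, Cmod_R, Rabs_pos_eq by (trivial; apply Cmod_ge_0).
  field; exact H0.
Qed.

(** After rotating by [e], only the real part has to be bounded, and there the partial sums can be
    compared termwise. *)
Lemma Cmod_CSeries_le (u : nat -> C) :
  abs_summable u -> Cmod (CSeries u) <= Series (fun n => Cmod (u n)).
Proof.
  intros Hu. apply Cmod_le_of_directions.
  - apply Rle_trans with (sum_n (fun n => Cmod (u n)) 0).
    + rewrite sum_O; apply Cmod_ge_0.
    + apply sum_n_le_Series; [intros; apply Cmod_ge_0|exact Hu].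
  - intros e He. rewrite <- CSeries_scal by assumption. simpl.
    apply (is_series_le_bound (fun n => Re (e * u n)%C)).
    + apply Series_correct, (abs_summable_Re (fun n => (e * u n)%C)). now apply abs_summable_scal.
    + intros N. eapply Rle_trans; [|apply (sum_n_le_Series _ N); [|exact Hu]].
      * apply sum_n_m_le. intros n. eapply Rle_trans; [apply Rle_abs|].
        eapply Rle_trans; [apply re_le_Cmod|]. rewrite Cmod_mult, He. lra.
      * intros; apply Cmod_ge_0.
Qed.

(** * Averages over roots of unity *)

Definition cis (t : R) : C := (cos t, sin t).

Lemma cis_plus (s t : R) : cis (s + t) = (cis s * cis t)%C.
Proof.
  unfold cis, Cmult; simpl. rewrite cos_plus, sin_plus. f_equal; ring.
Qed.

Lemma cis_pow (t : R) (n : nat) : (cis t ^ n)%C = cis (INR n * t).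
Proof.
  induction n as [|n IH].
  - simpl. unfold cis. rewrite Rmult_0_l, cos_0, sin_0. reflexivity.
  - rewrite Cpow_S, IH, <- cis_plus. f_equal. rewrite S_INR. ring.
Qed.

Lemma Cmod_cis (t : R) : Cmod (cis t) = 1.
Proof.
  unfold Cmod, cis; simpl. replace (_ + _) with 1; [apply sqrt_1|].
  generalize (sin2_cos2 t); unfold Rsqr; lra.
Qed.

Lemma Cconj_unit (e : C) : Cmod e = 1 -> (e * Cconj e)%C = RtoC 1.
Proof.
  intros H. rewrite <- Cmod2_conj, H. f_equal; ring.
Qed.

Lemma cis_neq_1 (t : R) : 0 < t < 2 * PI -> cis t <> RtoC 1.
Proof.
  intros Ht H. apply (f_equal fst) in H. simpl in H.
  replace t with (2 * (t / 2)) in H by field.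
  rewrite cos_2a_sin in H.
  assert (0 < sin (t / 2)) by (apply sin_gt_0; lra).
  nra.
Qed.

(** The order is [S n], to match the [S n] terms of [sum_n _ n]. *)
Definition unity_root (n k : nat) : C := cis (2 * PI * INR k / INR (S n)).

(** Exchanging the two exponents turns a sum over the roots into a geometric sum over [k]. *)
Lemma unity_root_pow (n k j : nat) :
  (unity_root n k ^ j)%C = (cis (2 * PI * INR j / INR (S n)) ^ k)%C.
Proof.
  unfold unity_root. rewrite !cis_pow. f_equal. field. apply not_0_INR; lia.
Qed.

Lemma geometric_sum (q : C) (n : nat) :
  ((1 - q) * sum_n (fun k => q ^ k)%C n)%C = (1 - q ^ S n)%C.
Proof.
  induction n as [|n IH].
  - rewrite sum_O. rewrite Cpow_S. simpl. ring.
  - rewrite sum_Sn. change plus with Cplus. rewrite Cmult_plus_distr_l, IH.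
    rewrite (Cpow_S q (S n)). ring.
Qed.

(** The ratio [q] of the geometric sum satisfies [q^(n+1) = 1], and [0 < j <= n] guarantees
    [q <> 1]. *)
Lemma unity_root_sum (n j : nat) : (0 < j <= n)%nat ->
  sum_n (fun k => (unity_root n k ^ j)%C) n = RtoC 0.
Proof.
  intros Hj. set (q := cis (2 * PI * INR j / INR (S n))).
  rewrite (sum_n_ext _ (fun k => q ^ k)%C) by (intros k; apply unity_root_pow).
  assert (HN : 0 < INR (S n)) by (apply lt_0_INR; lia).
  assert (Hq : (1 - q)%C <> RtoC 0).
  { intros E. apply (cis_neq_1 (2 * PI * INR j / INR (S n))).
    - assert (0 < INR j) by (apply lt_0_INR; lia).
      assert (INR j < INR (S n)) by (apply lt_INR; lia).
      generalize PI_RGT_0; intros.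
      split; [apply Rdiv_lt_0_compat; nra|].
      apply Rmult_lt_reg_r with (INR (S n)); [exact HN|].
      unfold Rdiv; rewrite Rmult_assoc, Rinv_l by lra. nra.
    - fold q. replace q with (1 - (1 - q))%C by cring. rewrite E. cring. }
  assert (Hn : (q ^ S n)%C = RtoC 1).
  { unfold q. rewrite cis_pow.
    replace (INR (S n) * _) with (0 + 2 * INR j * PI) by (field; lra).
    unfold cis. rewrite cos_period, sin_period, cos_0, sin_0. reflexivity. }
  generalize (geometric_sum q n). rewrite Hn. intros E.
  replace (sum_n (fun k => q ^ k)%C n) with (/ (1 - q) * ((1 - q) * sum_n (fun k => q ^ k)%C n))%C
    by (field; exact Hq).
  rewrite E. cring.
Qed.

Lemma sum_n_const_C (c : C) (n : nat) : sum_n (fun _ => c) n = (INR (S n) * c)%C.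
Proof.
  induction n as [|n IH].
  - rewrite sum_O. simpl. cring.
  - rewrite sum_Sn, IH. change plus with Cplus. rewrite (S_INR (S n)), RtoC_plus. cring.
Qed.

Lemma Cconj_sum_n (u : nat -> C) (n : nat) :
  Cconj (sum_n u n) = sum_n (fun k => Cconj (u k)) n.
Proof.
  induction n as [|n IH]; [now rewrite !sum_O|].
  rewrite !sum_Sn, <- IH. apply Cplus_conj.
Qed.

Lemma Cpow_unit_conj (e : C) (i d : nat) : Cmod e = 1 ->
  (e ^ (i + d) * Cconj e ^ i)%C = (e ^ d)%C.
Proof.
  intros He. rewrite Cpow_add_r.
  replace (e ^ i * e ^ d * Cconj e ^ i)%C with ((e ^ i * Cconj e ^ i) * e ^ d)%C by cring.
  rewrite <- Cpow_mult_l, Cconj_unit, Cpow_1_l by exact He. cring.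
Qed.

Lemma unity_root_orthogonal (n i j : nat) : (i <= n)%nat -> (j <= n)%nat ->
  sum_n (fun k => (unity_root n k ^ i * Cconj (unity_root n k) ^ j)%C) n
  = if Nat.eqb i j then RtoC (INR (S n)) else RtoC 0.
Proof.
  assert (Hlt : forall i j, (i <= n)%nat -> (j < i)%nat ->
    sum_n (fun k => (unity_root n k ^ i * Cconj (unity_root n k) ^ j)%C) n = RtoC 0).
  { clear i j; intros i j Hi Hj.
    rewrite <- (unity_root_sum n (i - j)) by lia.
    apply sum_n_ext; intros k. replace i with (j + (i - j))%nat at 1 by lia.
    apply Cpow_unit_conj, Cmod_cis. }
  intros Hi Hj. destruct (Nat.eqb_spec i j) as [->|Hne].
  - rewrite (sum_n_ext _ (fun _ => RtoC 1)).
    + rewrite sum_n_const_C. cring.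
    + intros k. rewrite <- (Nat.add_0_r j) at 1. apply Cpow_unit_conj, Cmod_cis.
  - destruct (Nat.lt_total i j) as [H|[H|H]]; [|contradiction|now apply Hlt].
    (* The case [i < j] is the conjugate of the case already treated. *)
    rewrite <- (Cconj_conj (sum_n _ n)), Cconj_sum_n.
    rewrite (sum_n_ext _ (fun k => (unity_root n k ^ j * Cconj (unity_root n k) ^ i)%C)).
    + rewrite Hlt by lia. unfold Cconj, RtoC; simpl; f_equal; ring.
    + intros k. rewrite Cmult_conj, !Cpow_conj, Cconj_conj. cring.
Qed.

Lemma sum_n_bilinear (p q : nat -> C) (x y : nat -> nat -> C) (M n : nat) :
  sum_n (fun k => (sum_n (fun i => p i * x i k) M * sum_n (fun j => q j * y j k) M)%C) n
  = sum_n (fun i => sum_n (fun j =>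
      (p i * q j * sum_n (fun k => x i k * y j k) n)%C) M) M.
Proof.
  rewrite (sum_n_ext _ (fun k => sum_n (fun i =>
    sum_n (fun j => (p i * q j * (x i k * y j k))%C) M) M)).
  - rewrite sum_n_switch. apply sum_n_ext; intros i.
    rewrite sum_n_switch. apply sum_n_ext; intros j.
    apply (sum_n_mult_l (K := C_Ring)).
  - intros k. rewrite <- (sum_n_mult_r (K := C_Ring)). apply sum_n_ext; intros i.
    rewrite <- (sum_n_mult_l (K := C_Ring)). apply sum_n_ext; intros j.
    change mult with Cmult. cring.
Qed.

Lemma sum_n_delta (u : nat -> C) (j M : nat) :
  sum_n (fun i => if Nat.eqb i j then u i else RtoC 0) M
  = if Nat.leb j M then u j else RtoC 0.
Proof.
  induction M as [|M IH].
  - rewrite sum_O. destruct (Nat.eqb_spec 0 j), (Nat.leb_spec j 0); subst; trivial; lia.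
  - rewrite sum_Sn, IH. change plus with Cplus.
    destruct (Nat.eqb_spec (S M) j), (Nat.leb_spec j M), (Nat.leb_spec j (S M));
      subst; try lia; cring.
Qed.

Definition Cpoly (p : nat -> C) (M : nat) (z : C) : C := sum_n (fun i => (p i * z ^ i)%C) M.

Lemma Re_mult_Re (a b : C) : Re a * Re b = / 2 * Re (a * b + a * Cconj b)%C.
Proof.
  destruct a, b; unfold Re, Cplus, Cmult, Cconj; simpl. field.
Qed.

(** By [Re_mult_Re], the product splits into [p q] and [p Cconj q]. The first has degree at most
    [2 M], below the number of roots, so only its constant term survives; the second is evaluated by
    orthogonality. *)
Lemma mean_Re_mult (p q : nat -> C) (M : nat) :
  sum_n (fun k => Re (Cpoly p M (unity_root (2 * M) k)) * Re (Cpoly q M (unity_root (2 * M) k)))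
    (2 * M)
  = INR (S (2 * M)) / 2 *
    Re (p 0%nat * q 0%nat + sum_n (fun m => p m * Cconj (q m)) M)%C.
Proof.
  set (n := (2 * M)%nat).
  rewrite (sum_n_ext _ (fun k => / 2 *
    Re (Cpoly p M (unity_root n k) * Cpoly q M (unity_root n k) +
        Cpoly p M (unity_root n k) * Cconj (Cpoly q M (unity_root n k)))%C))
    by (intros k; apply Re_mult_Re).
  rewrite (sum_n_mult_l (K := R_Ring)). rewrite <- Re_sum_n.
  unfold Rdiv. rewrite (Rmult_comm (INR (S n))), Rmult_assoc.
  change mult with Rmult. f_equal.
  change (fun k => Cplus ?f ?g) with (fun k => plus f g).
  rewrite (sum_n_plus (G := C_AbelianMonoid)
    (fun k => (Cpoly p M (unity_root n k) * Cpoly q M (unity_root n k))%C)).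
  assert (E1 : sum_n (fun k => (Cpoly p M (unity_root n k) * Cpoly q M (unity_root n k))%C) n
               = (INR (S n) * (p 0%nat * q 0%nat))%C).
  { unfold Cpoly. rewrite (sum_n_bilinear p q (fun i k => unity_root n k ^ i)%C
      (fun j k => unity_root n k ^ j)%C).
    rewrite (sum_n_ext_loc _ (fun i => if Nat.eqb i 0 then
      (INR (S n) * (p i * q 0%nat))%C else RtoC 0)).
    - rewrite sum_n_delta. reflexivity.
    - intros i Hi.
      rewrite (sum_n_ext_loc _ (fun j => if Nat.eqb j 0 then
        (if Nat.eqb i 0 then (INR (S n) * (p i * q j))%C else RtoC 0) else RtoC 0)).
      + rewrite sum_n_delta. reflexivity.
      + intros j Hj.
        rewrite (sum_n_ext _ (fun k => (unity_root n k ^ (i + j))%C))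
          by (intros k; now rewrite Cpow_add_r).
        destruct (Nat.eqb_spec j 0) as [->|Hj0], (Nat.eqb_spec i 0) as [->|Hi0].
        * rewrite (sum_n_ext _ (fun _ => RtoC 1)) by reflexivity.
          rewrite sum_n_const_C. cring.
        * rewrite unity_root_sum by (unfold n; lia). cring.
        * rewrite unity_root_sum by (unfold n; lia). cring.
        * rewrite unity_root_sum by (unfold n; lia). cring. }
  assert (E2 : sum_n (fun k => (Cpoly p M (unity_root n k) * Cconj (Cpoly q M (unity_root n k)))%C) n
               = (INR (S n) * sum_n (fun m => p m * Cconj (q m)) M)%C).
  { rewrite (sum_n_ext _ (fun k => (sum_n (fun i => p i * unity_root n k ^ i) M *
      sum_n (fun j => Cconj (q j) * Cconj (unity_root n k) ^ j) M)%C)).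
    - rewrite (sum_n_bilinear p (fun j => Cconj (q j)) (fun i k => unity_root n k ^ i)%C
        (fun j k => Cconj (unity_root n k) ^ j)%C).
      rewrite <- (sum_n_mult_l (K := C_Ring)).
      apply sum_n_ext_loc; intros i Hi.
      rewrite (sum_n_ext_loc _ (fun j => if Nat.eqb j i then
        (INR (S n) * (p i * Cconj (q j)))%C else RtoC 0)).
      + rewrite sum_n_delta. destruct (Nat.leb_spec i M); [reflexivity|lia].
      + intros j Hj. rewrite unity_root_orthogonal by (unfold n; lia).
        rewrite Nat.eqb_sym. destruct (Nat.eqb_spec j i); cring.
    - intros k. unfold Cpoly. rewrite Cconj_sum_n. f_equal.
      apply sum_n_ext; intros j. now rewrite Cmult_conj, Cpow_conj. }
  rewrite E1, E2. change plus with Cplus. rewrite <- Cmult_plus_distr_l.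
  rewrite re_scal_l. reflexivity.
Qed.

Lemma Cmod_CSeries_tail (u : nat -> C) (M : nat) : abs_summable u ->
  Cmod (CSeries u - sum_n u M)%C
  <= Series (fun n => Cmod (u n)) - sum_n (fun n => Cmod (u n)) M.
Proof.
  intros Hu.
  assert (Ht : forall m, abs_summable (fun k => u (m + k)%nat)).
  { intros m. now apply (ex_series_incr_n (fun n => Cmod (u n)) m). }
  assert (E : CSeries u = (sum_n u M + CSeries (fun k => u (S M + k)%nat))%C).
  { induction M as [|M IH].
    - rewrite sum_O. now apply CSeries_incr.
    - rewrite sum_Sn. change plus with Cplus. rewrite IH.
      rewrite (CSeries_incr _ (Ht (S M))), Nat.add_0_r, Cplus_assoc.
      f_equal. apply CSeries_ext. intros n. f_equal. lia. }
  rewrite E. rewrite (Series_incr_n _ (S M)) by (trivial; lia). simpl pred.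
  rewrite <- sum_n_Reals.
  replace (_ - _)%C with (CSeries (fun k => u (S M + k)%nat))%C by cring.
  eapply Rle_trans; [apply Cmod_CSeries_le, Ht|].
  match goal with |- _ <= ?a + ?b - ?c => change (b <= a + b - a) end. lra.
Qed.

Lemma abs_summable_unit (u : nat -> C) (e : C) : Cmod e = 1 ->
  abs_summable u -> abs_summable (fun n => (u n * e ^ n)%C).
Proof.
  intros He. apply ex_series_ext. intros n.
  rewrite Cmod_mult, Cmod_pow, He, pow1. rring.
Qed.

Lemma Cpoly_tail (p : nat -> C) (M : nat) (e : C) : Cmod e = 1 -> abs_summable p ->
  Cmod (CSeries (fun n => p n * e ^ n) - Cpoly p M e)%C
  <= Series (fun n => Cmod (p n)) - sum_n (fun n => Cmod (p n)) M.
Proof.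
  intros He Hp.
  assert (E : forall n, Cmod (p n * e ^ n)%C = Cmod (p n)).
  { intros n. rewrite Cmod_mult, Cmod_pow, He, pow1. rring. }
  rewrite <- (Series_ext _ _ E), <- (sum_n_ext _ _ M E).
  now apply Cmod_CSeries_tail, abs_summable_unit.
Qed.

Lemma Cpoly_unit_bound (p : nat -> C) (M : nat) (e : C) : Cmod e = 1 -> abs_summable p ->
  Cmod (Cpoly p M e) <= Series (fun n => Cmod (p n)).
Proof.
  intros He Hp. eapply Rle_trans; [apply Cmod_sum_n|].
  eapply Rle_trans; [|apply (sum_n_le_Series _ M); [intros; apply Cmod_ge_0|exact Hp]].
  apply sum_n_m_le. intros n. rewrite Cmod_mult, Cmod_pow, He, pow1. lra.
Qed.

(** A truncation of a series with nonnegative real part is only almost nonnegative. Here [s], [t]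
    are the tails and [a], [b] uniform bounds, so the error of the product vanishes with the
    tails. *)
Lemma mult_lower_bound (x y s t a b : R) :
  - s <= x -> Rabs x <= a -> - t <= y -> Rabs y <= b -> 0 <= s -> 0 <= t ->
  - (s * b + t * a) <= x * y.
Proof.
  intros H1 H2 H3 H4 Hs Ht.
  apply Rabs_le_between in H2. apply Rabs_le_between in H4.
  destruct (Rle_or_lt 0 x), (Rle_or_lt 0 y); nra.
Qed.

(* Twice the mean of [Re P * Re Q] over the unit circle is the left-hand side;
   it is computed on truncations, averaged over sufficiently many roots of unity. *)
Lemma Re_pairing_nonneg (p q : nat -> C) :
  abs_summable p -> abs_summable q ->
  (forall e, Cmod e = 1 -> 0 <= Re (CSeries (fun n => p n * e ^ n)%C)) ->
  (forall e, Cmod e = 1 -> 0 <= Re (CSeries (fun n => q n * e ^ n)%C)) ->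
  0 <= Re (p 0%nat * q 0%nat + CSeries (fun n => p n * Cconj (q n)))%C.
Proof.
  intros Hp Hq Pp Pq.
  set (a := Series (fun n => Cmod (p n))). set (b := Series (fun n => Cmod (q n))).
  set (s := fun M => a - sum_n (fun n => Cmod (p n)) M).
  set (t := fun M => b - sum_n (fun n => Cmod (q n)) M).
  assert (Hs : forall M, 0 <= s M).
  { intros M. generalize (sum_n_le_Series _ M (fun n => Cmod_ge_0 (p n)) Hp).
    unfold s, a; lra. }
  assert (Ht : forall M, 0 <= t M).
  { intros M. generalize (sum_n_le_Series _ M (fun n => Cmod_ge_0 (q n)) Hq).
    unfold t, b; lra. }
  assert (HM : forall M, - 2 * (s M * b + t M * a) <=
    Re (p 0%nat * q 0%nat + sum_n (fun m => p m * Cconj (q m)) M)%C).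
  { intros M.
    assert (Hk : forall k, - (s M * b + t M * a) <=
      Re (Cpoly p M (unity_root (2 * M) k)) * Re (Cpoly q M (unity_root (2 * M) k))).
    { intros k. set (e := unity_root (2 * M) k).
      assert (He : Cmod e = 1) by apply Cmod_cis.
      assert (Hl : forall r, abs_summable r ->
        0 <= Re (CSeries (fun n => r n * e ^ n)%C) ->
        - (Series (fun n => Cmod (r n)) - sum_n (fun n => Cmod (r n)) M)
        <= Re (Cpoly r M e)).
      { intros r Hr Pr. generalize (Cpoly_tail r M e He Hr).
        generalize (re_le_Cmod (CSeries (fun n => r n * e ^ n) - Cpoly r M e)%C).
        intros H1 H2. apply Rabs_le_between in H1.
        replace (Re (_ - _)%C) with (Re (CSeries (fun n => r n * e ^ n)%C) - Re (Cpoly r M e))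
          in H1 by reflexivity.
        lra. }
      apply mult_lower_bound; trivial.
      - now apply Hl; [|apply Pp].
      - eapply Rle_trans; [apply re_le_Cmod|now apply Cpoly_unit_bound].
      - now apply Hl; [|apply Pq].
      - eapply Rle_trans; [apply re_le_Cmod|now apply Cpoly_unit_bound]. }
    generalize (sum_n_m_le _ _ 0 (2 * M) Hk). fold (@sum_n R_AbelianMonoid).
    change (sum_n (fun _ => - (s M * b + t M * a)) (2 * M) <=
      sum_n (fun k => Re (Cpoly p M (unity_root (2 * M) k)) * Re (Cpoly q M (unity_root (2 * M) k)))
        (2 * M) -> - 2 * (s M * b + t M * a) <=
      Re (p 0%nat * q 0%nat + sum_n (fun m => p m * Cconj (q m)) M)%C).
    rewrite mean_Re_mult, sum_n_const.
    assert (0 < INR (S (2 * M))) by (apply lt_0_INR; lia).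
    intros HH. apply Rmult_le_reg_l with (INR (S (2 * M)) / 2); [lra|].
    eapply Rle_trans; [|apply HH]. right; field. }
  assert (Hpq : abs_summable (fun n => (p n * Cconj (q n))%C)).
  { apply (abs_summable_le _ (fun n => b * Cmod (p n))).
    - intros n. rewrite Cmod_mult, Cmod_conj, Rmult_comm.
      apply Rmult_le_compat_r; [apply Cmod_ge_0|].
      eapply Rle_trans; [|apply (sum_n_le_Series _ n); [intros; apply Cmod_ge_0|exact Hq]].
      destruct n; [rewrite sum_O; lra|]. rewrite sum_Sn.
      assert (0 <= sum_n (fun n => Cmod (q n)) n); [|unfold plus; simpl; lra].
      eapply Rle_trans; [|apply Cmod_sum_n]. apply Cmod_ge_0.
    - exact (ex_series_scal_l b _ Hp). }
  apply Rnot_lt_le; intros Hneg.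
  set (L := Re _) in Hneg.
  assert (Ha : 0 <= a) by (eapply Rle_trans; [|apply (sum_n_le_Series _ 0 (fun n => Cmod_ge_0 (p n)) Hp)];
    rewrite sum_O; apply Cmod_ge_0).
  assert (Hb : 0 <= b) by (eapply Rle_trans; [|apply (sum_n_le_Series _ 0 (fun n => Cmod_ge_0 (q n)) Hq)];
    rewrite sum_O; apply Cmod_ge_0).
  (* The errors add up to at most [d (1 + 2 a + 2 b) = - L / 2], which would give [L > L / 2],
     impossible for [L < 0]. *)
  set (d := - L / (2 * (1 + 2 * a + 2 * b))).
  assert (Hd : 0 < d) by (apply Rdiv_lt_0_compat; lra).
  destruct (is_series_eps _ _ d (Series_correct _ Hp) Hd) as [N1 H1].
  destruct (is_series_eps _ _ d (Series_correct _ Hq) Hd) as [N2 H2].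
  destruct (is_series_eps _ _ d (is_series_Re _ _ (abs_summable_is_series _ Hpq)) Hd) as [N3 H3].
  set (M := (N1 + N2 + N3)%nat).
  specialize (H1 M ltac:(unfold M; lia)). specialize (H2 M ltac:(unfold M; lia)).
  specialize (H3 M ltac:(unfold M; lia)). specialize (HM M).
  apply Rabs_def2 in H1. apply Rabs_def2 in H2. apply Rabs_def2 in H3.
  rewrite <- Re_sum_n in H3.
  assert (s M <= d) by (unfold s, a in *; lra).
  assert (t M <= d) by (unfold t, b in *; lra).
  unfold Cplus in HM.
  assert (EL : L = Re (p 0%nat * q 0%nat)%C + Re (CSeries (fun n => p n * Cconj (q n))%C))
    by reflexivity.
  match type of HM with _ <= Re ?x => change (Re x) with
    (Re (p 0%nat * q 0%nat)%C + Re (sum_n (fun n => p n * Cconj (q n))%C M)) in HM end.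
  assert (Hdd : d * (2 * (1 + 2 * a + 2 * b)) = - L) by (unfold d; field; lra).
  assert (s M * b <= d * b) by (apply Rmult_le_compat_r; lra).
  assert (t M * a <= d * a) by (apply Rmult_le_compat_r; lra).
  generalize (Hs M) (Ht M); intros. nra.
Qed.

(** * Power series with positive real part *)

Definition Cdelta (n : nat) (x : C) (m : nat) : C := if Nat.eqb m n then x else RtoC 0.

Lemma abs_summable_Cdelta (n : nat) (x : C) : abs_summable (Cdelta n x).
Proof.
  apply (ex_series_incr_n (fun k => Cmod (Cdelta n x k)) (S n)).
  exists 0. apply (is_series_ext (fun _ => 0)); [|exact is_series_zero].
  intros k. unfold Cdelta. destruct (Nat.eqb_spec (S n + k) n); [lia|].
  symmetry; apply Cmod_0.
Qed.

Lemma CSeries_Cdelta (n : nat) (x : C) : CSeries (Cdelta n x) = x.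
Proof.
  revert x. induction n as [|n IH]; intros x;
    rewrite CSeries_incr by apply abs_summable_Cdelta.
  - rewrite (CSeries_ext _ (fun _ => RtoC 0)) by reflexivity.
    rewrite (is_series_CSeries _ (RtoC 0)); [apply Cplus_0_r|].
    apply is_series_pair; exact is_series_zero.
  - rewrite (CSeries_ext _ (Cdelta n x)) by reflexivity.
    rewrite IH. apply Cplus_0_l.
Qed.

Lemma Cgeom_abs_summable (v : C) : Cmod v < 1 -> abs_summable (fun n => (v ^ n)%C).
Proof.
  intros Hv. apply (abs_summable_le _ (fun n => Cmod v ^ n)).
  - intros n. rewrite Cmod_pow. lra.
  - apply ex_series_geom. rewrite Rabs_pos_eq; [exact Hv|apply Cmod_ge_0].
Qed.

Lemma one_minus_neq_0 (v : C) : Cmod v < 1 -> (1 - v)%C <> RtoC 0.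
Proof.
  intros Hv E. replace v with (1 - (1 - v))%C in Hv by ring.
  rewrite E in Hv. replace (1 - 0)%C with (RtoC 1) in Hv by ring.
  rewrite Cmod_1 in Hv. lra.
Qed.

Lemma CSeries_geom (v : C) : Cmod v < 1 -> CSeries (fun n => (v ^ n)%C) = (/ (1 - v))%C.
Proof.
  intros Hv. generalize (CSeries_incr _ (Cgeom_abs_summable v Hv)).
  rewrite (CSeries_ext (fun n => v ^ S n)%C (fun n => v * v ^ n)%C) by (intros; apply Cpow_S).
  rewrite CSeries_scal by now apply Cgeom_abs_summable.
  set (S := CSeries _). intros E. generalize (one_minus_neq_0 v Hv). intros H.
  replace (/ (1 - v))%C with (/ (1 - v) * ((1 + v * S) - v * S))%C by (field; exact H).
  replace (1 + v * S)%C with S by (rewrite E at 1; reflexivity).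
  field. exact H.
Qed.

(** The map is [(1 + v) / (1 - v)]; its real part is the Poisson kernel [(1 - |v|^2) / |1 - v|^2],
    and [|1 - v| <= 1 + |v|]. *)
Lemma Re_half_plane_map_lower (v : C) : Cmod v < 1 ->
  (1 - Cmod v) / (1 + Cmod v) <= Re (2 / (1 - v) - 1)%C.
Proof.
  intros Hv. generalize (one_minus_neq_0 v Hv). intros H.
  generalize (Cmod_ge_0 v). intros H0. generalize (Cmod2_alt v). intros Hsq.
  generalize (re_le_Cmod v). intros Hre. apply Rabs_le_between in Hre.
  destruct v as [x y]. simpl in Hre.
  set (r := Cmod (x, y)) in *.
  change (r ^ 2 = x ^ 2 + y ^ 2) in Hsq. change (- r <= x <= r) in Hre.
  assert (Hpos : 0 < (1 - x) ^ 2 + y ^ 2) by nra.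
  replace (Re (2 / (1 - (x, y)) - 1)%C) with ((1 - r ^ 2) / ((1 - x) ^ 2 + y ^ 2)).
  - replace ((1 - r) / (1 + r)) with ((1 - r ^ 2) / ((1 + r) ^ 2)) by (field; lra).
    apply Rmult_le_compat_l; [nra|]. apply Rinv_le_contravar; nra.
  - rewrite Hsq. unfold Re, Cdiv, Cminus, Cplus, Copp, Cinv, Cmult; simpl. field. nra.
Qed.

(** The kernel [q z = 1 - Cconj e z^n] has nonnegative real part on the circle, and pairing it with
    [p] yields [0 <= 2 p0 - Re (e p_n)]. *)
Lemma caratheodory_coefficient (p : nat -> C) (p0 : R) (n : nat) :
  abs_summable p -> p 0%nat = RtoC p0 ->
  (forall e, Cmod e = 1 -> 0 <= Re (CSeries (fun n => p n * e ^ n)%C)) ->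
  (0 < n)%nat -> Cmod (p n) <= 2 * p0.
Proof.
  intros Hp Hp0 Hpos Hn.
  assert (H : forall e, Cmod e = 1 -> Re (e * p n)%C <= 2 * p0).
  { intros e He.
    set (q := fun m => (Cdelta 0 1 m + Cdelta n (- Cconj e) m)%C).
    assert (Hq : abs_summable q) by (apply abs_summable_plus; apply abs_summable_Cdelta).
    assert (Pq : forall z, Cmod z = 1 -> 0 <= Re (CSeries (fun m => q m * z ^ m)%C)).
    { intros z Hz.
      rewrite (CSeries_ext _ (fun m : nat => Cdelta 0 1 m + Cdelta n (- Cconj e * z ^ n) m)%C).
      - rewrite CSeries_plus, !CSeries_Cdelta by apply abs_summable_Cdelta.
        generalize (re_le_Cmod (- Cconj e * z ^ n)%C).
        rewrite Cmod_mult, Cmod_opp, Cmod_conj, Cmod_pow, He, Hz, pow1.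
        intros Hr. apply Rabs_le_between in Hr.
        change (0 <= 1 + Re (- Cconj e * z ^ n)%C). lra.
      - intros m. unfold q, Cdelta. destruct (Nat.eqb_spec m 0), (Nat.eqb_spec m n);
          subst; try lia; try cring; simpl.
}
    generalize (Re_pairing_nonneg p q Hp Hq Hpos Pq).
    rewrite (CSeries_ext _ (fun m => Cdelta 0 p0 m + Cdelta n (- e * p n)%C m)%C).
    - rewrite CSeries_plus, !CSeries_Cdelta by apply abs_summable_Cdelta.
      rewrite Hp0. unfold q, Cdelta at 1; simpl Nat.eqb.
      unfold Cdelta. destruct (Nat.eqb_spec 0 n); [lia|].
      replace (p0 * (1 + 0) + (p0 + - e * p n))%C with (RtoC (2 * p0) - e * p n)%C
        by (rewrite RtoC_mult; cring).
      intros HH. change (0 <= 2 * p0 - Re (e * p n)%C) in HH. lra.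
    - intros m. unfold q, Cdelta. rewrite Cplus_conj.
      assert (C0 : Cconj 0 = RtoC 0) by (unfold Cconj, RtoC; simpl; f_equal; ring).
      assert (C1 : Cconj 1 = RtoC 1) by (unfold Cconj, RtoC; simpl; f_equal; ring).
      destruct (Nat.eqb_spec m 0), (Nat.eqb_spec m n);
          subst; try lia; rewrite ?C0, ?C1, ?Copp_conj, ?Cconj_conj, ?Hp0; try cring.
}
  apply Cmod_le_of_directions; [|exact H].
  (* Adding the bounds for [e = 1] and [e = -1] gives [0 <= p0]. *)
  generalize (H 1%C Cmod_1) (H (- (1))%C Cmod_m1).
  replace (- (1) * p n)%C with (- (1 * p n))%C by cring.
  replace (Re (- (1 * p n))%C) with (- Re (1 * p n)%C) by reflexivity. lra.
Qed.

(** The kernel is [q z = 2 / (1 - Cconj w z) - 1 - c], the Poisson kernel lowered by its minimum [c]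
    on the circle. Pairing it with [p] yields [2 (Re P(w) - c p0)], where [P] is the power series of
    [p]. *)
Lemma harnack_lower (p : nat -> C) (p0 : R) (w : C) :
  abs_summable p -> p 0%nat = RtoC p0 ->
  (forall e, Cmod e = 1 -> 0 <= Re (CSeries (fun n => p n * e ^ n)%C)) ->
  Cmod w < 1 ->
  (1 - Cmod w) / (1 + Cmod w) * p0 <= Re (CSeries (fun n => p n * w ^ n)%C).
Proof.
  intros Hp Hp0 Hpos Hw. set (c := (1 - Cmod w) / (1 + Cmod w)).
  set (q := fun m => (2 * Cconj w ^ m + Cdelta 0 (RtoC (- 1 - c)) m)%C).
  assert (Hg : forall v : C, Cmod v < 1 -> abs_summable (fun m => (2 * v ^ m)%C)).
  { intros v Hv. now apply (abs_summable_scal 2), Cgeom_abs_summable. }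
  assert (Hq : abs_summable q).
  { apply (abs_summable_plus (fun m => 2 * Cconj w ^ m)%C); [|apply abs_summable_Cdelta].
    apply Hg. now rewrite Cmod_conj. }
  assert (Pq : forall z, Cmod z = 1 -> 0 <= Re (CSeries (fun m => q m * z ^ m)%C)).
  { intros z Hz.
    assert (Ev : Cmod (Cconj w * z)%C = Cmod w) by (rewrite Cmod_mult, Cmod_conj, Hz; ring).
    assert (Hv : Cmod (Cconj w * z)%C < 1) by lra.
    rewrite (CSeries_ext _ (fun m => 2 * (Cconj w * z) ^ m + Cdelta 0 (RtoC (- 1 - c)) m)%C).
    - rewrite CSeries_plus, CSeries_Cdelta by (try apply abs_summable_Cdelta; now apply Hg).
      rewrite CSeries_scal, CSeries_geom by (trivial; now apply Cgeom_abs_summable).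
      generalize (Re_half_plane_map_lower _ Hv). rewrite Ev. fold c. unfold Cdiv.
      set (x := (2 * / (1 - Cconj w * z))%C).
      change (c <= Re x - 1 -> 0 <= Re x + (- 1 - c)). lra.
    - intros m. unfold q, Cdelta. rewrite Cpow_mult_l.
      destruct (Nat.eqb_spec m 0) as [->|]; [simpl|]; cring. }
  generalize (Re_pairing_nonneg p q Hp Hq Hpos Pq).
  assert (Hpw : abs_summable (fun m => (p m * w ^ m)%C)).
  { apply (abs_summable_le _ (fun m => Cmod (p m))); [|exact Hp].
    intros m. rewrite Cmod_mult, Cmod_pow. rewrite <- (Rmult_1_r (Cmod (p m))) at 2.
    apply Rmult_le_compat_l; [apply Cmod_ge_0|].
    rewrite <- (pow1 m). apply pow_incr. split; [apply Cmod_ge_0|lra]. }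
  rewrite (CSeries_ext _ (fun m => 2 * (p m * w ^ m) + Cdelta 0 (RtoC ((- 1 - c) * p0)) m)%C).
  - rewrite CSeries_plus, CSeries_Cdelta
      by (try apply abs_summable_Cdelta; now apply (abs_summable_scal 2 (fun m => p m * w ^ m)%C)).
    rewrite (CSeries_scal 2 (fun m => p m * w ^ m)%C) by exact Hpw.
    rewrite Hp0. unfold q, Cdelta; simpl Nat.eqb; cbv iota. simpl Cpow.
    set (x := CSeries _).
    replace (p0 * (2 * 1 + RtoC (- 1 - c)) + (2 * x + RtoC ((- 1 - c) * p0)))%C
      with (RtoC 2 * (x - RtoC (c * p0)))%C
      by (clearbody x; destruct x; unfold RtoC, Cmult, Cplus, Cminus, Copp, Cplus; simpl; f_equal; ring).
    rewrite re_scal_l. intros HH.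
    change (0 <= 2 * (Re x - c * p0)) in HH. lra.
  - intros m. unfold q, Cdelta. rewrite Cplus_conj, Cmult_conj, Cpow_conj, Cconj_conj.
    assert (CR : forall x : R, Cconj x = RtoC x) by (intros; unfold Cconj, RtoC; simpl; f_equal; ring).
    destruct (Nat.eqb_spec m 0) as [->|]; rewrite !CR; [rewrite Hp0, RtoC_mult; simpl|]; cring.
Qed.

Lemma CV_radius_of_bounded (A : nat -> R) (M x : R) :
  (forall n, Rabs (A n) <= M) -> Rabs x < 1 -> Rbar_lt (Rabs x) (CV_radius A).
Proof.
  intros HA Hx. apply Rbar_lt_le_trans with 1; [exact Hx|].
  apply (proj1 (CV_radius_bounded A)). exists M. intros n. rewrite pow1, Rmult_1_r. apply HA.
Qed.

(* With [B = sum A_n / (1 + g n) t^n] one has [A = B + g t B'], which would be negative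
   at a negative minimum of [B] on [[0, t]]. *)
Lemma PSeries_div_linear_nonneg (A : nat -> R) (M g : R) : 0 <= g ->
  (forall n, Rabs (A n) <= M) ->
  (forall t, 0 <= t < 1 -> 0 <= PSeries A t) ->
  forall t, 0 <= t < 1 -> 0 <= PSeries (fun n => A n / (1 + g * INR n)) t.
Proof.
  intros Hg HA Hpos T HT. set (b := fun n => A n / (1 + g * INR n)).
  assert (Hd : forall n, 1 <= 1 + g * INR n) by (intros n; generalize (pos_INR n); nra).
  assert (Hb : forall n, Rabs (b n) <= M).
  { intros n. specialize (HA n). specialize (Hd n). unfold b, Rdiv.
    rewrite Rabs_mult, (Rabs_pos_eq (/ _)) by (left; apply Rinv_0_lt_compat; lra).
    apply Rle_trans with (Rabs (A n)); [|exact HA].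
    rewrite <- (Rmult_1_r (Rabs (A n))) at 2. apply Rmult_le_compat_l; [apply Rabs_pos|].
    rewrite <- Rinv_1. apply Rinv_le_contravar; lra. }
  assert (Hr : forall x, 0 <= x < 1 -> Rbar_lt (Rabs x) (CV_radius b)).
  { intros x Hx. apply (CV_radius_of_bounded b M); [exact Hb|]. rewrite Rabs_pos_eq; lra. }
  assert (Hode : forall x, 0 <= x < 1 ->
    PSeries A x = PSeries b x + g * (x * PSeries (PS_derive b) x)).
  { intros x Hx. rewrite <- PSeries_incr_1.
    rewrite <- PSeries_scal, <- PSeries_plus.
    - apply PSeries_ext. intros [|n]; unfold PS_plus, PS_scal, PS_incr_1, PS_derive, b.
      + change plus with Rplus; change scal with Rmult; unfold zero; simpl. field.
      + change plus with Rplus; change scal with Rmult. field.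
        generalize (Hd (S n)); lra.
    - now apply CV_radius_inside, Hr.
    - apply ex_pseries_scal; [apply Rmult_comm|]. apply ex_pseries_incr_1, ex_pseries_derive, Hr, Hx. }
  destruct (continuity_ab_min (PSeries b) 0 T) as [m [Hm1 Hm2]]; [lra| |].
  { intros c Hc. apply PSeries_continuity, Hr. lra. }
  apply Rle_trans with (PSeries b m); [|apply Hm1; lra].
  apply Rnot_lt_le; intros Hneg.
  assert (Hm3 : 0 <= m < 1) by lra.
  assert (HA0 := Hpos m Hm3). rewrite Hode in HA0 by exact Hm3.
  destruct (Req_dec m 0) as [E|Hm0]; [rewrite E, Rmult_0_l in HA0; rewrite E in Hneg; lra|].
  set (l := PSeries (PS_derive b) m) in *.
  assert (Hl : 0 < l) by (destruct (Rle_or_lt l 0); [exfalso|assumption];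
    assert (m * l <= 0) by nra; nra).
  assert (HD : derivable_pt_lim (PSeries b) m l)
    by (apply is_derive_Reals, is_derive_PSeries, Hr, Hm3).
  destruct (HD l Hl) as [d Hdl].
  generalize (cond_pos d); intros Hdp.
  (* The derivative at [m] is positive, so a step to the left lowers the value. Such a step stays in
     [[0, T]] even if the minimum is at [T], and [h <= m] keeps the point nonnegative. *)
  set (h := Rmin (d / 2) m).
  assert (Hh : 0 < h) by (apply Rmin_glb_lt; lra).
  assert (Hh1 : h <= d / 2) by apply Rmin_l. assert (Hh2 : h <= m) by apply Rmin_r.
  specialize (Hdl (- h)).
  specialize (Hm1 (m + - h)).
  assert (HQ : Rabs ((PSeries b (m + - h) - PSeries b m) / - h - l) < l).
  { apply Hdl; [lra|]. rewrite Rabs_Ropp, Rabs_pos_eq; lra. }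
  apply Rabs_def2 in HQ.
  assert (0 < (PSeries b (m + - h) - PSeries b m) / - h) by lra.
  assert (PSeries b (m + - h) - PSeries b m < 0); [|lra].
  replace (PSeries b (m + - h) - PSeries b m)
    with ((PSeries b (m + - h) - PSeries b m) / - h * - h) by (field; lra).
  nra.
Qed.

(* Taylor coefficients of [(1 - t) / (1 + t)]. *)
Definition half_plane_coef (n : nat) : R := if Nat.eqb n 0 then 1 else 2 * (-1) ^ n.

Lemma half_plane_coef_bound (n : nat) : Rabs (half_plane_coef n) <= 2.
Proof.
  unfold half_plane_coef. destruct (Nat.eqb n 0).
  - rewrite Rabs_R1; lra.
  - rewrite Rabs_mult, pow_1_abs, (Rabs_pos_eq 2); lra.
Qed.

Lemma PSeries_half_plane (t : R) : 0 <= t < 1 ->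
  PSeries half_plane_coef t = (1 - t) / (1 + t).
Proof.
  intros Ht. unfold PSeries.
  assert (Hg : Rabs (- t) < 1) by (rewrite Rabs_Ropp, Rabs_pos_eq; lra).
  assert (Hs : is_series (fun n => 2 * (- t) ^ n) (2 * / (1 - - t)))
    by exact (is_series_scal 2 (fun n => (- t) ^ n) _ (is_series_geom _ Hg)).
  rewrite Series_incr_1.
  - rewrite (Series_ext _ (fun k => 2 * (- t) ^ S k)).
    + generalize (Series_incr_1 _ (ex_intro _ _ Hs)).
      rewrite (is_series_unique _ _ Hs). unfold half_plane_coef; simpl Nat.eqb; cbv iota.
      intros E. replace (Series (fun k => 2 * (- t) ^ S k)) with (2 * / (1 - - t) - 2 * (- t) ^ 0) by lra.
      simpl. field. lra.
    + intros n. unfold half_plane_coef; simpl Nat.eqb; cbv iota.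
      replace (- t) with (-1 * t) by ring. rewrite Rpow_mult_distr. ring.
  - apply ex_pseries_R, CV_radius_inside, (CV_radius_of_bounded _ 2 _ half_plane_coef_bound).
    rewrite Rabs_pos_eq; lra.
Qed.

(** The denominator is [D_(n+1)] rather than [D_n], because the estimate concerns [F z / z]. *)
Definition growth_coef (alpha : R) (n : nat) : R :=
  half_plane_coef n / ((INR n + 1) * (1 + alpha * INR n)).

Lemma growth_denominator_ge_1 (alpha : R) (n : nat) : 0 <= alpha ->
  1 <= (INR n + 1) * (1 + alpha * INR n).
Proof.
  intros Ha. generalize (pos_INR n); intros Hn.
  assert (0 <= alpha * INR n) by (apply Rmult_le_pos; assumption). nra.
Qed.

Lemma Rabs_div_ge_1 (x d : R) : 1 <= d -> Rabs (x / d) <= Rabs x.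
Proof.
  intros Hd. unfold Rdiv. rewrite Rabs_mult, (Rabs_pos_eq (/ d))
    by (left; apply Rinv_0_lt_compat; lra).
  rewrite <- (Rmult_1_r (Rabs x)) at 2. apply Rmult_le_compat_l; [apply Rabs_pos|].
  rewrite <- Rinv_1. apply Rinv_le_contravar; lra.
Qed.

Lemma growth_coef_bound (alpha : R) (n : nat) : 0 <= alpha -> Rabs (growth_coef alpha n) <= 2.
Proof.
  intros Ha. eapply Rle_trans; [|apply (half_plane_coef_bound n)].
  now apply Rabs_div_ge_1, growth_denominator_ge_1.
Qed.

Lemma unit_direction (w : C) : exists e, Cmod e = 1 /\ w = (Cmod w * e)%C.
Proof.
  destruct (Req_dec (Cmod w) 0) as [H|H].
  - exists 1%C. split; [apply Cmod_1|]. rewrite H, (Cmod_eq_0 w H). cring.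
  - assert (Hc : RtoC (Cmod w) <> RtoC 0) by (intros E; apply H; now apply RtoC_inj).
    exists (w / Cmod w)%C. split.
    + rewrite Cmod_div, Cmod_R, Rabs_pos_eq by (trivial; apply Cmod_ge_0). now field.
    + field. exact Hc.
Qed.

(** On the ray through [w = r e] everything becomes a real power series in [t]. Harnack's inequality
    says that the series with coefficients [A_n = Re (p_n e^n) - p0 half_plane_coef n] is
    nonnegative on [[0, 1)], and this survives division by [1 + alpha n] and then by [1 + n]. *)
Lemma growth_lower (alpha p0 : R) (p : nat -> C) (w : C) : 0 <= alpha ->
  abs_summable p -> p 0%nat = RtoC p0 ->
  (forall e, Cmod e = 1 -> 0 <= Re (CSeries (fun n => p n * e ^ n)%C)) ->
  Cmod w < 1 ->
  p0 * PSeries (growth_coef alpha) (Cmod w)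
  <= Re (CSeries (fun n => p n / RtoC ((INR n + 1) * (1 + alpha * INR n)) * w ^ n)%C).
Proof.
  intros Ha Hp Hp0 Hpos Hw.
  destruct (unit_direction w) as [e [He Ew]].
  set (r := Cmod w) in *. assert (Hr : 0 <= r < 1) by (split; [apply Cmod_ge_0|exact Hw]).
  assert (Hp0pos : 0 <= p0).
  { generalize (caratheodory_coefficient p p0 1 Hp Hp0 Hpos Nat.lt_0_1) (Cmod_ge_0 (p 1%nat)). lra. }
  assert (Hpb : forall n, Cmod (p n) <= 2 * p0).
  { intros [|n]; [|apply (caratheodory_coefficient p p0); trivial; lia].
    rewrite Hp0, Cmod_R, Rabs_pos_eq; lra. }
  set (x := fun n => Re (p n * e ^ n)%C).
  assert (Hx : forall n, Rabs (x n) <= 2 * p0).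
  { intros n. eapply Rle_trans; [apply re_le_Cmod|].
    rewrite Cmod_mult, Cmod_pow, He, pow1, Rmult_1_r. apply Hpb. }
  set (A := fun n => x n - p0 * half_plane_coef n).
  assert (HA : forall n, Rabs (A n) <= 4 * p0).
  { intros n. unfold A. eapply Rle_trans; [apply Rabs_triang|].
    rewrite Rabs_Ropp, Rabs_mult, (Rabs_pos_eq p0) by exact Hp0pos.
    generalize (Hx n) (half_plane_coef_bound n); intros. nra. }
  assert (Hex : forall (u : nat -> R) M t, (forall n, Rabs (u n) <= M) -> 0 <= t < 1 ->
    ex_series (fun n => u n * t ^ n)).
  { intros u M t Hu Ht. apply ex_pseries_R, CV_radius_inside, (CV_radius_of_bounded _ M _ Hu).
    rewrite Rabs_pos_eq; lra. }
  assert (Hsub : forall (u v : nat -> R) M t, (forall n, Rabs (u n) <= M) ->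
    (forall n, Rabs (v n) <= M) -> 0 <= t < 1 ->
    PSeries (fun n => u n - p0 * v n) t = Series (fun n => u n * t ^ n) - p0 * PSeries v t).
  { intros u v M t Hu Hv Ht. unfold PSeries. rewrite <- Series_scal_l, <- Series_minus.
    - apply Series_ext; intros n. ring.
    - now apply (Hex u M).
    - apply (ex_series_scal_l p0 (fun n => v n * t ^ n)). now apply (Hex v M). }
  assert (Hdir : forall (c : C) n t, (c * (RtoC t * e) ^ n)%C = (RtoC (t ^ n) * (c * e ^ n))%C).
  { intros c n t. rewrite Cpow_mult_l, RtoC_pow. cring. }
  assert (HApos : forall t, 0 <= t < 1 -> 0 <= PSeries A t).
  { intros t Ht. unfold A. rewrite (Hsub _ _ (2 + 2 * p0)); [|intros n; specialize (Hx n); lra|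
      intros n; generalize (half_plane_coef_bound n); lra|exact Ht].
    rewrite PSeries_half_plane by exact Ht.
    assert (Et : Cmod (t * e)%C = t) by (rewrite Cmod_mult, Cmod_R, He, Rabs_pos_eq; lra).
    generalize (harnack_lower p p0 (t * e)%C Hp Hp0 Hpos).
    rewrite Et. intros HH. specialize (HH ltac:(lra)).
    replace (Series (fun n => x n * t ^ n)) with (Re (CSeries (fun n => p n * (t * e) ^ n)%C)); [lra|].
    simpl. apply Series_ext; intros n.
    change (Re (p n * (t * e) ^ n)%C = x n * t ^ n).
    rewrite Hdir, re_scal_l. unfold x. ring. }
  assert (H1 := PSeries_div_linear_nonneg A (4 * p0) alpha Ha HA HApos).
  assert (HA1 : forall n, Rabs (A n / (1 + alpha * INR n)) <= 4 * p0).
  { intros n. eapply Rle_trans; [apply Rabs_div_ge_1|apply HA].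
    generalize (pos_INR n); nra. }
  assert (H2 := PSeries_div_linear_nonneg _ (4 * p0) 1 Rle_0_1 HA1 H1 r Hr).
  assert (Hd : forall n, 0 < (INR n + 1) * (1 + alpha * INR n))
    by (intros n; generalize (growth_denominator_ge_1 alpha n Ha); lra).
  rewrite (PSeries_ext _ (fun n => x n / ((INR n + 1) * (1 + alpha * INR n)) - p0 * growth_coef alpha n)) in H2.
  - rewrite (Hsub (fun n => x n / ((INR n + 1) * (1 + alpha * INR n))) _ (2 + 2 * p0)) in H2; trivial.
    + replace (Re (CSeries _)) with (Series (fun n => x n / ((INR n + 1) * (1 + alpha * INR n)) * r ^ n)); [lra|].
      simpl. apply Series_ext; intros n.
      set (d := (INR n + 1) * (1 + alpha * INR n)).
      change (x n / d * r ^ n = Re (p n / RtoC d * w ^ n)%C).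
      rewrite Ew, Hdir, re_scal_l.
      replace (p n / RtoC d * e ^ n)%C with (RtoC (/ d) * (p n * e ^ n))%C
        by (rewrite RtoC_inv by (generalize (Hd n); unfold d; lra); unfold Cdiv; cring).
      rewrite re_scal_l. unfold x, Rdiv. ring.
    + intros n. eapply Rle_trans; [apply Rabs_div_ge_1; now apply growth_denominator_ge_1|].
      generalize (Hx n); lra.
    + intros n. generalize (growth_coef_bound alpha n Ha). lra.
  - intros n. generalize (Hd n); intros Hn. unfold A, growth_coef. field.
    generalize (pos_INR n); intros. split; nra.
Qed.

(** * Complex power series and analytic functions in the disk *)

Lemma is_derive_C_elim (f : C -> C) (z l : C) (eps : R) : is_derive f z l -> 0 < eps ->
  exists d, 0 < d /\ forall w, Cmod (w - z)%C < d ->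
    Cmod (f w - f z - (w - z) * l)%C <= eps * Cmod (w - z)%C.
Proof.
  intros [_ H] He.
  destruct (H z (fun P HP => HP) (mkposreal eps He)) as [d Hd].
  exists d; split; [apply cond_pos|exact Hd].
Qed.

Lemma is_derive_C_intro (f : C -> C) (z l : C) :
  (forall eps, 0 < eps -> exists d, 0 < d /\ forall w, Cmod (w - z)%C < d ->
    Cmod (f w - f z - (w - z) * l)%C <= eps * Cmod (w - z)%C) ->
  is_derive f z l.
Proof.
  intros H. split.
  - apply (is_linear_scal_l (K := C_AbsRing) (V := C_NormedModule) l).
  - intros x Hx. rewrite <- (is_filter_lim_locally_unique (V := AbsRing_NormedModule C_AbsRing) z x Hx).
    intros [eps He]. destruct (H eps He) as [d [Hd H']].
    exists (mkposreal d Hd). exact H'.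
Qed.

Definition Cpseries (c : nat -> C) (z : C) : C := CSeries (fun n => (c n * z ^ n)%C).

Definition disk_summable (c : nat -> C) : Prop :=
  forall r, 0 <= r < 1 -> ex_series (fun n => Cmod (c n) * r ^ n).

Lemma disk_summable_at (c : nat -> C) (z : C) : disk_summable c -> Cmod z < 1 ->
  abs_summable (fun n => (c n * z ^ n)%C).
Proof.
  intros Hc Hz. apply (abs_summable_le _ (fun n => Cmod (c n) * Cmod z ^ n)).
  - intros n. rewrite Cmod_mult, Cmod_pow. lra.
  - apply Hc. split; [apply Cmod_ge_0|exact Hz].
Qed.

Lemma CV_radius_ge_1 (x : nat -> R) :
  (forall r, 0 <= r < 1 -> ex_series (fun n => x n * r ^ n)) -> Rbar_le 1 (CV_radius x).
Proof.
  intros H. apply Rbar_not_lt_le; intros Hlt. assert (H0 := CV_radius_ge_0 x).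
  destruct (CV_radius x) as [y| |] eqn:E; simpl in Hlt, H0; try easy.
  apply (CV_disk_outside x ((y + 1) / 2)).
  - rewrite E. simpl. rewrite Rabs_pos_eq; lra.
  - apply ex_series_lim_0, H. lra.
Qed.

Lemma disk_summable_radius (c : nat -> C) :
  disk_summable c <-> Rbar_le 1 (CV_radius (fun n => Cmod (c n))).
Proof.
  split; [exact (CV_radius_ge_1 _)|].
  - intros H r Hr.
    apply ex_series_ext with (fun n => Rabs (Cmod (c n) * r ^ n)).
    + intros n. apply Rabs_pos_eq, Rmult_le_pos; [apply Cmod_ge_0|apply pow_le; lra].
    + apply (CV_disk_inside (fun n => Cmod (c n))). eapply Rbar_lt_le_trans; [|exact H].
      simpl. rewrite Rabs_pos_eq; lra.
Qed.

Definition Cderive_coef (c : nat -> C) (n : nat) : C := (RtoC (INR (S n)) * c (S n))%C.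

Lemma disk_summable_derive (c : nat -> C) : disk_summable c -> disk_summable (Cderive_coef c).
Proof.
  rewrite !disk_summable_radius. rewrite <- (CV_radius_derive (fun n => Cmod (c n))).
  intros H. rewrite (CV_radius_ext _ (PS_derive (fun n => Cmod (c n)))); [exact H|]. intros n.
  unfold PS_derive, Cderive_coef. rewrite Cmod_mult, Cmod_R, Rabs_pos_eq by apply pos_INR.
  reflexivity.
Qed.

(* [w^(n+1) - z^(n+1) - (n+1) z^n (w-z) = w (w^n - z^n - n z^(n-1) (w-z)) + n z^(n-1) (w-z)^2];
   the estimate is multiplied by [rho^2] to avoid the exponent [n - 2]. *)
Lemma Cpow_taylor (w z : C) (rho : R) (n : nat) :
  Cmod w <= rho -> Cmod z <= rho ->
  Cmod (w ^ n - z ^ n - RtoC (INR n) * z ^ pred n * (w - z))%C * rho ^ 2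
  <= INR n ^ 2 * rho ^ n * Cmod (w - z)%C ^ 2.
Proof.
  intros Hw Hz. assert (Hr : 0 <= rho) by (generalize (Cmod_ge_0 w); lra).
  set (d := Cmod (w - z)%C).
  induction n as [|n IH].
  - replace (w ^ 0 - z ^ 0 - RtoC (INR 0) * z ^ pred 0 * (w - z))%C with (RtoC 0)
      by (simpl; cring).
    rewrite Cmod_0. simpl. lra.
  - set (E := (w ^ n - z ^ n - RtoC (INR n) * z ^ pred n * (w - z))%C) in *.
    assert (ES : (w ^ S n - z ^ S n - RtoC (INR (S n)) * z ^ pred (S n) * (w - z))%C
      = (w * E + RtoC (INR n) * z ^ pred n * (w - z) * (w - z))%C).
    { unfold E. rewrite S_INR, RtoC_plus. simpl pred. rewrite !Cpow_S.
      destruct n as [|n]; [simpl; cring|]. simpl pred. rewrite !Cpow_S. cring. }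
    rewrite ES.
    assert (Hn : INR n * Cmod z ^ pred n * rho ^ 2 <= INR n * rho ^ S n).
    { destruct n as [|n]; [simpl; lra|]. simpl pred.
      assert (Hp : Cmod z ^ n <= rho ^ n) by (apply pow_incr; split; [apply Cmod_ge_0|exact Hz]).
      rewrite Rmult_assoc. apply Rmult_le_compat_l; [apply pos_INR|].
      simpl. rewrite Rmult_1_r.
      apply Rle_trans with (rho ^ n * (rho * rho)); [|right; ring].
      apply Rmult_le_compat_r; [nra|exact Hp]. }
    apply Rle_trans with ((Cmod w * Cmod E + INR n * Cmod z ^ pred n * d * d) * rho ^ 2).
    + apply Rmult_le_compat_r; [apply pow2_ge_0|].
      eapply Rle_trans; [apply Cmod_triangle|].
      rewrite !Cmod_mult, Cmod_R, Cmod_pow, (Rabs_pos_eq (INR n)) by apply pos_INR.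
      unfold d. lra.
    + rewrite Rmult_plus_distr_r.
      assert (H1 : Cmod w * Cmod E * rho ^ 2 <= rho * (INR n ^ 2 * rho ^ n * d ^ 2)).
      { rewrite Rmult_assoc. apply Rmult_le_compat; trivial; [apply Cmod_ge_0|].
        apply Rmult_le_pos; [apply Cmod_ge_0|apply pow2_ge_0]. }
      assert (H2 : INR n * Cmod z ^ pred n * d * d * rho ^ 2 <= INR n * rho ^ S n * d ^ 2).
      { replace (INR n * Cmod z ^ pred n * d * d * rho ^ 2)
          with (INR n * Cmod z ^ pred n * rho ^ 2 * d ^ 2) by ring.
        apply Rmult_le_compat_r; [apply pow2_ge_0|exact Hn]. }
      rewrite S_INR.
      assert (H3 : 0 <= rho ^ S n * d ^ 2) by (apply Rmult_le_pos; [now apply pow_le|apply pow2_ge_0]).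
      generalize (pos_INR n); intros Hn0.
      apply Rle_trans with ((INR n ^ 2 + INR n) * (rho ^ S n * d ^ 2)); [simpl in *; lra|].
      rewrite Rmult_assoc. apply Rmult_le_compat_r; [exact H3|]. nra.
Qed.

Lemma ex_series_INR2 (c : nat -> C) (r : R) : disk_summable c -> 0 <= r < 1 ->
  ex_series (fun n => INR n ^ 2 * (Cmod (c n) * r ^ n)).
Proof.
  intros Hc Hr.
  assert (H1 := disk_summable_derive _ Hc r Hr).
  assert (H2 := disk_summable_derive _ (disk_summable_derive _ Hc) r Hr).
  apply ex_series_incr_1.
  (* [n^2 = n + n (n - 1)] *)
  apply (ex_series_ext (fun n => r * (Cmod (Cderive_coef c n) * r ^ n)
    + (match n with O => 0 | S m => r ^ 2 * (Cmod (Cderive_coef (Cderive_coef c) m) * r ^ m) end))).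
  - intros n. unfold Cderive_coef. destruct n as [|n]; rewrite ?Cmod_mult, ?Cmod_R, ?Rabs_pos_eq by apply pos_INR.
    + simpl. rring.
    + rewrite !S_INR. simpl pow. rring.
  - apply (ex_series_plus (V := R_NormedModule)).
    + exact (ex_series_scal_l r _ H1).
    + apply ex_series_incr_1. exact (ex_series_scal_l (r ^ 2) _ H2).
Qed.

(** Summing the Taylor estimate of each power against [|c_n|] bounds the remainder by [K |w - z|^2],
    where [rho] lies halfway between [|z|] and 1. *)
Lemma is_derive_Cpseries (c : nat -> C) (z : C) : disk_summable c -> Cmod z < 1 ->
  is_derive (Cpseries c) z (Cpseries (Cderive_coef c) z).
Proof.
  intros Hc Hz. generalize (Cmod_ge_0 z); intros Hz0.
  set (rho := (1 + Cmod z) / 2).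
  assert (Hrho : 0 < rho < 1) by (unfold rho; lra).
  assert (Hzr : Cmod z < rho) by (unfold rho; lra).
  set (K := Series (fun n => INR n ^ 2 * (Cmod (c n) * rho ^ n)) / rho ^ 2).
  assert (HKs : ex_series (fun n => INR n ^ 2 * (Cmod (c n) * rho ^ n)))
    by (apply ex_series_INR2; trivial; lra).
  assert (Hr2 : 0 < rho ^ 2) by nra.
  assert (HK : 0 <= K).
  { apply Rmult_le_pos; [|left; now apply Rinv_0_lt_compat].
    eapply Rle_trans; [|apply (sum_n_le_Series _ 0); [|exact HKs]].
    - rewrite sum_O. simpl. lra.
    - intros n. apply Rmult_le_pos; [apply pow2_ge_0|].
      apply Rmult_le_pos; [apply Cmod_ge_0|apply pow_le; lra]. }
  apply is_derive_C_intro. intros eps He.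
  (* The first bound keeps [|w|] below [rho]; the summand 1 avoids a division by zero when
     [K = 0]. *)
  exists (Rmin (rho - Cmod z) (eps / (K + 1))). split.
  { apply Rmin_glb_lt; [lra|]. apply Rdiv_lt_0_compat; lra. }
  intros w Hw.
  assert (Hw1 : Cmod (w - z)%C < rho - Cmod z) by (eapply Rlt_le_trans; [exact Hw|apply Rmin_l]).
  assert (Hw2 : Cmod (w - z)%C < eps / (K + 1)) by (eapply Rlt_le_trans; [exact Hw|apply Rmin_r]).
  assert (Hwr : Cmod w < rho).
  { replace w with ((w - z) + z)%C by cring. eapply Rle_lt_trans; [apply Cmod_triangle|]. lra. }
  set (u := fun n => (c n * (w ^ n - z ^ n - RtoC (INR n) * z ^ pred n * (w - z)))%C).
  set (d := Cmod (w - z)%C) in *.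
  assert (Hd : 0 <= d) by apply Cmod_ge_0.
  assert (Hu : forall n, Cmod (u n) <= d ^ 2 / rho ^ 2 * (INR n ^ 2 * (Cmod (c n) * rho ^ n))).
  { intros n. unfold u. rewrite Cmod_mult.
    generalize (Cpow_taylor w z rho n (Rlt_le _ _ Hwr) (Rlt_le _ _ Hzr)). fold d.
    set (x := Cmod (_ - _ - _)%C). intros Hx.
    apply Rmult_le_reg_r with (rho ^ 2); [exact Hr2|].
    replace (d ^ 2 / rho ^ 2 * (INR n ^ 2 * (Cmod (c n) * rho ^ n)) * rho ^ 2)
      with (Cmod (c n) * (INR n ^ 2 * rho ^ n * d ^ 2)) by (field; lra).
    rewrite Rmult_assoc. apply Rmult_le_compat_l; [apply Cmod_ge_0|exact Hx]. }
  assert (Hus : ex_series (fun n => d ^ 2 / rho ^ 2 * (INR n ^ 2 * (Cmod (c n) * rho ^ n))))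
    by exact (ex_series_scal_l (d ^ 2 / rho ^ 2) _ HKs).
  assert (Hua : abs_summable u) by exact (abs_summable_le _ _ Hu Hus).
  assert (Hcw : abs_summable (fun n => (c n * w ^ n)%C)) by (apply disk_summable_at; trivial; lra).
  assert (Hcz : abs_summable (fun n => (c n * z ^ n)%C)) by (apply disk_summable_at; trivial; lra).
  assert (Hdz : abs_summable (fun n => (Cderive_coef c n * z ^ n)%C))
    by (apply disk_summable_at; trivial; now apply disk_summable_derive).
  assert (E : (Cpseries c w - Cpseries c z - (w - z) * Cpseries (Cderive_coef c) z)%C = CSeries u).
  { set (v := fun n => (RtoC (INR n) * c n * z ^ pred n)%C).
    assert (Hv : abs_summable v).
    { apply abs_summable_incr. revert Hdz. apply abs_summable_ext. intros n.
      unfold v, Cderive_coef. simpl pred. reflexivity. }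
    assert (Ev : CSeries v = Cpseries (Cderive_coef c) z).
    { rewrite CSeries_incr by exact Hv. unfold v at 1.
      replace (RtoC (INR 0) * c 0%nat * z ^ pred 0)%C with (RtoC 0) by (simpl; cring).
      rewrite Cplus_0_l. reflexivity. }
    rewrite <- Ev. unfold Cpseries.
    rewrite (CSeries_ext u (fun n => (c n * w ^ n + ((- (1)) * (c n * z ^ n) + (z - w) * v n))%C))
      by (intros n; unfold u, v; cring).
    rewrite CSeries_plus; trivial.
    - rewrite CSeries_plus, !CSeries_scal; trivial.
      + cring.
      + now apply (abs_summable_scal (- (1)) (fun n => c n * z ^ n)%C).
      + now apply abs_summable_scal.
    - apply (abs_summable_plus (fun n => (- (1)) * (c n * z ^ n))%C).
      + now apply (abs_summable_scal (- (1)) (fun n => c n * z ^ n)%C).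
      + now apply abs_summable_scal. }
  rewrite E. eapply Rle_trans; [now apply Cmod_CSeries_le|].
  eapply Rle_trans; [apply Series_le; [|exact Hus]; intros n; split; [apply Cmod_ge_0|apply Hu]|].
  rewrite Series_scal_l.
  replace (d ^ 2 / rho ^ 2 * Series (fun n => INR n ^ 2 * (Cmod (c n) * rho ^ n)))
    with (K * d * d) by (unfold K; field; lra).
  apply Rmult_le_compat_r; [exact Hd|].
  assert (d * (K + 1) <= eps).
  { apply Rlt_le. apply (Rmult_lt_compat_r (K + 1)) in Hw2; [|lra].
    unfold Rdiv in Hw2. rewrite Rmult_assoc, Rinv_l in Hw2 by lra. lra. }
  nra.
Qed.

Lemma is_derive_disk_ext (f g : C -> C) (z l : C) :
  (forall w, unit_disk w -> f w = g w) -> unit_disk z -> is_derive f z l -> is_derive g z l.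
Proof.
  unfold unit_disk. intros Hfg Hz H. apply is_derive_C_intro. intros eps He.
  destruct (is_derive_C_elim f z l eps H He) as [d [Hd Hd']].
  exists (Rmin d (1 - Cmod z)). split; [apply Rmin_glb_lt; lra|].
  intros w Hw. rewrite <- !Hfg; trivial.
  - apply Hd'. eapply Rlt_le_trans; [exact Hw|apply Rmin_l].
  - replace w with ((w - z) + z)%C by cring. eapply Rle_lt_trans; [apply Cmod_triangle|].
    generalize (Rmin_r d (1 - Cmod z)). lra.
Qed.

Lemma Cmod_le_eps_eq_0 (z : C) : (forall eps, 0 < eps -> Cmod z <= eps) -> z = RtoC 0.
Proof.
  intros H. apply Cmod_eq_0. destruct (Rle_lt_or_eq_dec 0 (Cmod z) (Cmod_ge_0 z)) as [Hz|]; [|easy].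
  specialize (H (Cmod z / 2)). lra.
Qed.

(* The difference quotients of [u] and of [Cconj v] along the real and imaginary axes
   give [l = Cconj m] and [l = - Cconj m]. *)
Lemma is_derive_conj_zero (u v : C -> C) (z : C) :
  (forall w, unit_disk w -> u w = Cconj (v w)) -> unit_disk z ->
  ex_derive u z -> ex_derive v z -> is_derive u z (RtoC 0).
Proof.
  unfold unit_disk. intros Huv Hz [l Hl] [m Hm].
  (* The increment of [u] from [z] to [z + s e] is [s e l] to first order, and, read through
     [Cconj v], it is [s Cconj e Cconj m]. *)
  assert (Hdir : forall e eps, Cmod e = 1 -> 0 < eps ->
    Cmod (e * l - Cconj e * Cconj m)%C <= 2 * eps).
  { intros e eps He Heps.
    destruct (is_derive_C_elim u z l eps Hl Heps) as [d1 [Hd1 H1]].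
    destruct (is_derive_C_elim v z m eps Hm Heps) as [d2 [Hd2 H2]].
    set (s := Rmin (Rmin d1 d2) (1 - Cmod z) / 2).
    assert (Hs0 : 0 < Rmin (Rmin d1 d2) (1 - Cmod z)) by (repeat apply Rmin_glb_lt; lra).
    assert (Hs : 0 < s) by (unfold s; lra).
    assert (Hs1 : s < d1 /\ s < d2 /\ s < 1 - Cmod z).
    { generalize (Rmin_l (Rmin d1 d2) (1 - Cmod z)) (Rmin_r (Rmin d1 d2) (1 - Cmod z))
        (Rmin_l d1 d2) (Rmin_r d1 d2). unfold s. lra. }
    set (w := (z + RtoC s * e)%C).
    assert (Ew : (w - z)%C = (RtoC s * e)%C) by (unfold w; cring).
    assert (Em : Cmod (w - z)%C = s) by (rewrite Ew, Cmod_mult, Cmod_R, He, Rabs_pos_eq; lra).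
    assert (Hw : Cmod w < 1).
    { unfold w. eapply Rle_lt_trans; [apply Cmod_triangle|]. rewrite <- Ew, Em. lra. }
    specialize (H1 w ltac:(lra)). specialize (H2 w ltac:(lra)).
    rewrite <- Cmod_conj, !Cminus_conj, <- !Huv, Cmult_conj in H2 by lra.
    rewrite Em in H1, H2. rewrite Ew in H1, H2. rewrite Cmult_conj in H2.
    replace (Cconj (RtoC s)) with (RtoC s) in H2 by (unfold Cconj, RtoC; simpl; f_equal; ring).
    apply Rmult_le_reg_l with s; [exact Hs|].
    rewrite <- (Rabs_pos_eq s) at 1 by lra. rewrite <- Cmod_R, <- Cmod_mult.
    replace (RtoC s * (e * l - Cconj e * Cconj m))%C with
      ((u w - u z - RtoC s * Cconj e * Cconj m) + - (u w - u z - RtoC s * e * l))%C by cring.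
    eapply Rle_trans; [apply Cmod_triangle|]. rewrite Cmod_opp. lra. }
  assert (H0 : l = RtoC 0).
  { apply Cmod_le_eps_eq_0. intros eps He.
    assert (H1 := Hdir 1%C (eps / 2) Cmod_1 ltac:(lra)).
    assert (H2 := Hdir Ci (eps / 2) Cmod_Ci ltac:(lra)).
    replace (Cconj 1) with (RtoC 1) in H1 by (unfold Cconj, RtoC; simpl; f_equal; ring).
    replace (Ci * l - Cconj Ci * Cconj m)%C with (Ci * (l + Cconj m))%C in H2
      by (destruct l, m; unfold Ci, Cconj, Cminus, Copp, Cplus, Cmult; simpl; f_equal; ring).
    rewrite Cmod_mult, Cmod_Ci, Rmult_1_l in H2.
    replace (1 * l - 1 * Cconj m)%C with (l - Cconj m)%C in H1 by cring.
    assert (H3 : Cmod (2 * l)%C <= 2 * eps).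
    { replace (2 * l)%C with ((l + Cconj m) + (l - Cconj m))%C by cring.
      eapply Rle_trans; [apply Cmod_triangle|]. lra. }
    rewrite Cmod_mult, Cmod_R, Rabs_pos_eq in H3 by lra. lra. }
  now rewrite <- H0.
Qed.

(** On the segment from 0 to [z], the real function [Re (k u(t z))] has zero derivative; [k = 1] and
    [k = - Ci] recover the real and imaginary parts of [u]. *)
Lemma is_derive_zero_const (u : C -> C) :
  (forall z, unit_disk z -> is_derive u z (RtoC 0)) ->
  forall z, unit_disk z -> u z = u (RtoC 0).
Proof.
  unfold unit_disk. intros Hu z Hz.
  assert (H : forall k : C, Cmod k = 1 -> Re (k * u z)%C = Re (k * u (RtoC 0))%C).
  { intros k Hk. set (f := fun t : R => Re (k * u (RtoC t * z))%C).
    assert (Hf : f 0 = f 1).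
    { apply (eq_is_derive (V := R_NormedModule)); [|lra]. intros t Ht.
      assert (Hm : Cmod (RtoC t * z)%C < 1).
      { rewrite Cmod_mult, Cmod_R, Rabs_pos_eq by lra. generalize (Cmod_ge_0 z). nra. }
      apply is_derive_Reals. intros eps He.
      destruct (is_derive_C_elim u _ _ (eps / 2) (Hu _ Hm)) as [d [Hd H]]; [lra|].
      exists (mkposreal d Hd). simpl. intros h Hh Hhd.
      assert (Ew : (RtoC (t + h) * z - RtoC t * z)%C = (RtoC h * z)%C)
        by (rewrite RtoC_plus; cring).
      specialize (H (RtoC (t + h) * z)%C). rewrite Ew, Cmod_mult, Cmod_R in H.
      generalize (Cmod_ge_0 z) (Rabs_pos_lt h Hh); intros Hz0 Hh0.
      assert (Hlt : Rabs h * Cmod z < d).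
      { apply Rle_lt_trans with (Rabs h * 1); [apply Rmult_le_compat_l; lra|].
        rewrite Rmult_1_r. exact Hhd. }
      specialize (H Hlt). rewrite Cmult_0_r in H.
      rewrite Rminus_0_r. unfold Rdiv. rewrite Rabs_mult, Rabs_inv.
      apply Rmult_lt_reg_r with (Rabs h); [exact Hh0|].
      rewrite Rmult_assoc, Rinv_l, Rmult_1_r by lra.
      replace (f (t + h) - f t) with (Re (k * (u (RtoC (t + h) * z) - u (RtoC t * z) - 0))%C).
      - eapply Rle_lt_trans; [apply re_le_Cmod|]. rewrite Cmod_mult, Hk, Rmult_1_l.
        eapply Rle_lt_trans; [exact H|].
        apply Rle_lt_trans with (eps / 2 * (Rabs h * 1)); [|nra].
        apply Rmult_le_compat_l; [lra|]. apply Rmult_le_compat_l; lra.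
      - unfold f. unfold Re, Cminus, Copp, Cplus, Cmult; simpl. ring. }
    unfold f in Hf. rewrite Cmult_0_l, Cmult_1_l in Hf. now symmetry. }
  apply injective_projections.
  - generalize (H 1%C Cmod_1). now rewrite !Cmult_1_l.
  - assert (Hi : Cmod (- Ci)%C = 1) by (now rewrite Cmod_opp, Cmod_Ci).
    generalize (H _ Hi). unfold Re, Ci, Copp, Cmult; simpl. lra.
Qed.

Lemma ex_series_disk_Rabs (x : nat -> R) :
  (forall r, 0 <= r < 1 -> ex_series (fun n => x n * r ^ n)) ->
  forall r, 0 <= r < 1 -> ex_series (fun n => Rabs (x n) * r ^ n).
Proof.
  intros H r Hr.
  apply ex_series_ext with (fun n => Rabs (x n * r ^ n)).
  { intros n. rewrite Rabs_mult, (Rabs_pos_eq (r ^ n)) by (apply pow_le; lra). reflexivity. }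
  apply (CV_disk_inside x). apply Rbar_lt_le_trans with 1; [simpl; rewrite Rabs_pos_eq; lra|].
  now apply CV_radius_ge_1.
Qed.

(** * Identification of the coefficients *)

(** [has_coefficients] leaves the entries 0 and 1 arbitrary; they are replaced by the normalized
    ones, with [c1 = 1] for the analytic and [c1 = 0] for the co-analytic part. *)
Definition full_coef (c1 : C) (a : nat -> C) (n : nat) : C :=
  match n with O => RtoC 0 | 1%nat => c1 | _ => a n end.

(** Only convergence, not absolute convergence, is given. Real and imaginary parts of the
    coefficients form real power series that converge at every radius below 1, hence have radius of
    convergence at least 1 and converge absolutely there. *)
Lemma disk_summable_full_coef (c1 : C) (a : nat -> C) :
  (forall z, unit_disk z ->
    exists l : C, is_series (fun k => (a (k + 2)%nat * z ^ (k + 2))%C) l) ->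
  disk_summable (full_coef c1 a).
Proof.
  intros H.
  assert (Hs : forall r k, (full_coef c1 a (2 + k) * RtoC r ^ (2 + k))%C
    = (a (k + 2)%nat * RtoC r ^ (k + 2))%C).
  { intros r k. now rewrite (Nat.add_comm k 2). }
  assert (Hd : forall r, 0 <= r < 1 -> unit_disk (RtoC r))
    by (intros r Hr; unfold unit_disk; rewrite Cmod_R, Rabs_pos_eq; lra).
  assert (H1 : forall r, 0 <= r < 1 -> ex_series (fun n => Re (full_coef c1 a n) * r ^ n)).
  { intros r Hr. destruct (H _ (Hd r Hr)) as [l Hl]. apply (ex_series_incr_n _ 2).
    exists (Re l). apply is_series_ext with (2 := is_series_Re _ _ Hl). intros k.
    rewrite <- Hs, <- RtoC_pow. rewrite re_scal_r. reflexivity. }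
  assert (H2 : forall r, 0 <= r < 1 -> ex_series (fun n => Im (full_coef c1 a n) * r ^ n)).
  { intros r Hr. destruct (H _ (Hd r Hr)) as [l Hl]. apply (ex_series_incr_n _ 2).
    exists (Im l). apply is_series_ext with (2 := is_series_Im _ _ Hl). intros k.
    rewrite <- Hs, <- RtoC_pow. rewrite im_scal_r. reflexivity. }
  intros r Hr.
  apply (ex_series_le (V := R_CompleteNormedModule) _
    (fun n => Rabs (Re (full_coef c1 a n)) * r ^ n + Rabs (Im (full_coef c1 a n)) * r ^ n)).
  - intros n. unfold norm; simpl; unfold abs; simpl.
    assert (0 <= r ^ n) by (apply pow_le; lra).
    rewrite Rabs_pos_eq by (apply Rmult_le_pos; [apply Cmod_ge_0|assumption]).
    rewrite <- Rmult_plus_distr_r. apply Rmult_le_compat_r; [assumption|apply Cmod_le_Re_Im].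
  - apply (ex_series_plus (V := R_NormedModule)); now apply ex_series_disk_Rabs.
Qed.

Lemma Cpseries_full_coef (c1 : C) (a : nat -> C) (z l : C) : disk_summable (full_coef c1 a) ->
  unit_disk z -> is_series (fun k => (a (k + 2)%nat * z ^ (k + 2))%C) l ->
  Cpseries (full_coef c1 a) z = (c1 * z + l)%C.
Proof.
  intros Hc Hz Hl. unfold Cpseries.
  assert (Hs := disk_summable_at _ z Hc Hz).
  rewrite CSeries_incr by exact Hs.
  rewrite CSeries_incr by now apply (abs_summable_incr (fun n => (full_coef c1 a n * z ^ n)%C)).
  rewrite (CSeries_ext _ (fun k => (a (k + 2)%nat * z ^ (k + 2))%C))
    by (intros k; now rewrite (Nat.add_comm k 2)).
  rewrite (is_series_CSeries _ _ Hl). simpl. cring.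
Qed.

Lemma Cpseries_at_0 (c : nat -> C) : Cpseries c (RtoC 0) = c 0%nat.
Proof.
  unfold Cpseries. rewrite (CSeries_ext _ (Cdelta 0 (c 0%nat))); [apply CSeries_Cdelta|].
  intros [|n]; unfold Cdelta; [|rewrite Cpow_S]; simpl; cring.
Qed.

(** The coefficients [D_(n+1) c_(n+1)] of [F' + alpha z F'']. *)
Definition weighted_coef (alpha : R) (c : nat -> C) (n : nat) : C :=
  (RtoC ((INR n + 1) * (1 + alpha * INR n)) * c (S n))%C.

Lemma Cpseries_operator (alpha : R) (c : nat -> C) (z : C) : disk_summable c -> Cmod z < 1 ->
  abs_summable (fun n => (weighted_coef alpha c n * z ^ n)%C) /\
  (Cpseries (Cderive_coef c) z + RtoC alpha * z * Cpseries (Cderive_coef (Cderive_coef c)) z)%C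
  = Cpseries (weighted_coef alpha c) z.
Proof.
  intros Hc Hz.
  assert (H1 := disk_summable_at _ z (disk_summable_derive _ Hc) Hz).
  assert (H2 := disk_summable_at _ z (disk_summable_derive _ (disk_summable_derive _ Hc)) Hz).
  set (v := fun n => match n with O => RtoC 0 | S m =>
    (RtoC alpha * z * (Cderive_coef (Cderive_coef c) m * z ^ m))%C end).
  assert (Hv : abs_summable v).
  { apply abs_summable_incr. exact (abs_summable_scal (RtoC alpha * z)%C _ H2). }
  assert (E : forall n, (Cderive_coef c n * z ^ n + v n)%C = (weighted_coef alpha c n * z ^ n)%C).
  { intros [|n]; unfold v, Cderive_coef, weighted_coef.
    - simpl. replace ((0 + 1) * (1 + alpha * 0)) with 1 by ring. cring.
    - rewrite !S_INR, !RtoC_mult, !RtoC_plus, RtoC_mult, !RtoC_plus. simpl Cpow. cring. }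
  split.
  - apply (abs_summable_ext _ _ E). now apply abs_summable_plus.
  - unfold Cpseries. rewrite <- (CSeries_ext _ _ E), CSeries_plus by assumption.
    f_equal. rewrite (CSeries_incr v) by exact Hv. unfold v at 1.
    change (fun n => v (S n)) with
      (fun n => RtoC alpha * z * (Cderive_coef (Cderive_coef c) n * z ^ n))%C.
    rewrite CSeries_scal by exact H2. cring.
Qed.

Lemma C_derive_Cpseries (h : C -> C) (c : nat -> C) : disk_summable c ->
  (forall z, unit_disk z -> h z = Cpseries c z) ->
  forall z, unit_disk z -> C_derive h z = Cpseries (Cderive_coef c) z.
Proof.
  intros Hc Hh z Hz. apply is_C_derive_unique.
  apply (is_derive_disk_ext (Cpseries c)); trivial.
  - intros w Hw. now rewrite Hh.
  - now apply is_derive_Cpseries.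
Qed.

(** The [h] and [g] inside [W0H] are existentially quantified and a priori unrelated to [a] and [b].
    Once they are identified, the hypothesis speaks only of the given coefficients. *)
Lemma W0H_expansion (alpha beta : R) (f : C -> C) (a b : nat -> C) :
  W0H alpha beta f -> has_coefficients f a b ->
  disk_summable (full_coef 1 a) /\ disk_summable (full_coef 0 b) /\
  (forall z, unit_disk z ->
    f z = (Cpseries (full_coef 1 a) z + Cconj (Cpseries (full_coef 0 b) z))%C) /\
  forall z, unit_disk z ->
    Cmod (Cpseries (weighted_coef alpha (full_coef 0 b)) z)
    < Re (Cpseries (weighted_coef alpha (full_coef 1 a)) z) - beta.
Proof.
  intros [h [g [[Hh [Hg [Hf [h0 [h1 [g0 g1]]]]]] HW]]] Hco.
  assert (Da : disk_summable (full_coef 1 a)).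
  { apply disk_summable_full_coef. intros z Hz. destruct (Hco z Hz) as [x [_ [Hx _]]]. now exists x. }
  assert (Db : disk_summable (full_coef 0 b)).
  { apply disk_summable_full_coef. intros z Hz. destruct (Hco z Hz) as [_ [x [_ [Hx _]]]]. now exists x. }
  assert (Ef : forall z, unit_disk z ->
    f z = (Cpseries (full_coef 1 a) z + Cconj (Cpseries (full_coef 0 b) z))%C).
  { intros z Hz. destruct (Hco z Hz) as [x [y [Hx [Hy ->]]]].
    rewrite (Cpseries_full_coef _ a z x), (Cpseries_full_coef _ b z y) by assumption.
    rewrite Cmult_1_l, Cmult_0_l, Cplus_0_l. reflexivity. }
  set (A := Cpseries (full_coef 1 a)) in *. set (B := Cpseries (full_coef 0 b)) in *.
  assert (D0 : unit_disk (RtoC 0)) by (unfold unit_disk; rewrite Cmod_0; lra).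
  assert (EA : forall z, unit_disk z -> is_derive (fun w => (h w - A w)%C) z (RtoC 0)).
  { intros z Hz. apply (is_derive_conj_zero _ (fun w => (B w - g w)%C)); trivial.
    - intros w Hw. rewrite Cminus_conj. generalize (Hf w Hw). rewrite (Ef w Hw).
      intros E. replace (h w) with ((h w + Cconj (g w)) - Cconj (g w))%C by cring.
      rewrite <- E. cring.
    - apply (ex_derive_minus (V := C_NormedModule) h A); [now apply Hh|].
      eexists. now apply is_derive_Cpseries.
    - apply (ex_derive_minus (V := C_NormedModule) B g); [|now apply Hg].
      eexists. now apply is_derive_Cpseries. }
  assert (Eh : forall z, unit_disk z -> h z = A z).
  { intros z Hz. generalize (is_derive_zero_const _ EA z Hz).
    unfold A at 2. rewrite h0, Cpseries_at_0. simpl full_coef.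
    intros E. replace (h z) with ((h z - A z) + A z)%C by cring. rewrite E. cring. }
  assert (Eg : forall z, unit_disk z -> g z = B z).
  { intros z Hz. rewrite <- (Cconj_conj (g z)), <- (Cconj_conj (B z)). f_equal.
    generalize (Hf z Hz). rewrite (Ef z Hz), (Eh z Hz). intros E.
    replace (Cconj (g z)) with ((A z + Cconj (g z)) - A z)%C by cring. rewrite <- E. cring. }
  repeat split; trivial.
  intros z Hz. specialize (HW z Hz).
  assert (Dh := C_derive_Cpseries h _ Da Eh). assert (Dg := C_derive_Cpseries g _ Db Eg).
  rewrite (C_derive_Cpseries _ _ (disk_summable_derive _ Da) Dh z Hz) in HW.
  rewrite (C_derive_Cpseries _ _ (disk_summable_derive _ Db) Dg z Hz) in HW.
  rewrite Dh, Dg in HW by exact Hz.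
  rewrite !(fun c Hc => proj2 (Cpseries_operator alpha c z Hc Hz)) in HW by assumption.
  exact HW.
Qed.

(** * Coefficient and growth estimates for the class *)

(** Lets [rho] tend to 1; this removes the dilation from the coefficient bound. *)
Lemma le_of_mult_pow_le (x M : R) (n : nat) :
  (forall rho, 0 <= rho < 1 -> x * rho ^ n <= M) -> x <= M.
Proof.
  intros H. apply Rnot_lt_le; intros Hlt.
  assert (Hc : continuity_pt (fun rho => x * rho ^ n) 1) by reg.
  destruct (Hc (x - M)) as [d [Hd Hd']]; [lra|].
  set (rho := 1 - Rmin (d / 2) 1).
  assert (H1 : 0 < Rmin (d / 2) 1) by (apply Rmin_glb_lt; lra).
  generalize (Rmin_l (d / 2) 1) (Rmin_r (d / 2) 1); intros H2 H3.
  specialize (Hd' rho). simpl in Hd'. unfold R_dist in Hd'. rewrite pow1 in Hd'.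
  specialize (H rho ltac:(unfold rho; lra)).
  assert (Hx : Rabs (x * rho ^ n - x * 1) < x - M).
  { apply Hd'. split.
    - split; [exact I|unfold rho; lra].
    - unfold rho. replace (1 - Rmin (d / 2) 1 - 1) with (- Rmin (d / 2) 1) by ring.
      rewrite Rabs_Ropp, Rabs_pos_eq; lra. }
  apply Rabs_def2 in Hx. lra.
Qed.

(** The lower bound for [Re (F z / z)], with the [beta] subtracted in [P] added back; its value at 1
    is [radius_rhs]. *)
Definition growth (alpha beta t : R) : R := beta + (1 - beta) * PSeries (growth_coef alpha) t.

(* Rotating the co-analytic part by [e] turns the two-sided hypothesis into
   [Re (P_A + e P_B - beta) > 0]; dilation by [rho] makes it valid on the closed disk. *)
Lemma dilated_positive (alpha beta rho : R) (A B : nat -> C) (e : C) :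
  0 <= rho < 1 -> disk_summable A -> disk_summable B -> Cmod e = 1 ->
  (forall z, unit_disk z -> Cmod (Cpseries (weighted_coef alpha B) z)
    < Re (Cpseries (weighted_coef alpha A) z) - beta) ->
  let p := fun n => ((weighted_coef alpha A n + e * weighted_coef alpha B n
                      + Cdelta 0 (RtoC (- beta)) n) * RtoC rho ^ n)%C in
  abs_summable p /\
  forall z, Cmod z = 1 -> 0 <= Re (CSeries (fun n => p n * z ^ n)%C).
Proof.
  intros Hrho HA HB He H p.
  assert (Hs : forall w, Cmod w < 1 ->
    abs_summable (fun n => weighted_coef alpha A n * w ^ n
      + (e * (weighted_coef alpha B n * w ^ n) + Cdelta 0 (RtoC (- beta)) n))%C
    /\ 0 <= Re (CSeries (fun n => weighted_coef alpha A n * w ^ n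
      + (e * (weighted_coef alpha B n * w ^ n) + Cdelta 0 (RtoC (- beta)) n)))%C).
  { intros w Hw.
    assert (SA := proj1 (Cpseries_operator alpha A w HA Hw)).
    assert (SB := proj1 (Cpseries_operator alpha B w HB Hw)).
    assert (SB' := abs_summable_scal e _ SB).
    assert (SD := abs_summable_Cdelta 0 (RtoC (- beta))).
    assert (SS := abs_summable_plus _ _ SB' SD).
    split; [exact (abs_summable_plus _ _ SA SS)|].
    rewrite (CSeries_plus _ _ SA SS), (CSeries_plus _ _ SB' SD), (CSeries_scal e _ SB), CSeries_Cdelta.
    fold (Cpseries (weighted_coef alpha A) w). fold (Cpseries (weighted_coef alpha B) w).
    specialize (H w Hw).
    generalize (re_le_Cmod (e * Cpseries (weighted_coef alpha B) w)%C).
    rewrite Cmod_mult, He, Rmult_1_l. intros HR. apply Rabs_le_between in HR.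
    set (x := Cpseries (weighted_coef alpha A) w) in *.
    set (y := (e * Cpseries (weighted_coef alpha B) w)%C) in *.
    change (0 <= Re x + (Re y + - beta)). lra. }
  assert (E : forall z n, (p n * z ^ n)%C = (weighted_coef alpha A n * (RtoC rho * z) ^ n
      + (e * (weighted_coef alpha B n * (RtoC rho * z) ^ n) + Cdelta 0 (RtoC (- beta)) n))%C).
  { intros z n. unfold p. rewrite Cpow_mult_l.
    destruct n as [|n]; unfold Cdelta; simpl Nat.eqb; cbv iota; [simpl Cpow|]; cring. }
  assert (Hm : forall z, Cmod z = 1 -> Cmod (RtoC rho * z)%C < 1)
    by (intros z Hz; rewrite Cmod_mult, Cmod_R, Hz, Rabs_pos_eq; lra).
  split.
  - apply (abs_summable_ext (fun n => p n * 1 ^ n)%C); [intros n; rewrite Cpow_1_l; cring|].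
    apply (abs_summable_ext _ _ (fun n => eq_sym (E 1%C n))). now apply Hs, Hm, Cmod_1.
  - intros z Hz. rewrite (CSeries_ext _ _ (E z)). now apply Hs, Hm.
Qed.

Lemma weighted_coef_0 (alpha : R) (c : nat -> C) : weighted_coef alpha c 0 = c 1%nat.
Proof.
  unfold weighted_coef. simpl INR. replace ((0 + 1) * (1 + alpha * 0)) with 1 by ring. cring.
Qed.

Lemma dilated_at_0 (alpha beta rho : R) (a b : nat -> C) (e : C) :
  ((weighted_coef alpha (full_coef 1 a) 0 + e * weighted_coef alpha (full_coef 0 b) 0
    + Cdelta 0 (RtoC (- beta)) 0) * RtoC rho ^ 0)%C = RtoC (1 - beta).
Proof.
  rewrite !weighted_coef_0. unfold Cdelta; simpl. rewrite RtoC_minus, RtoC_opp. cring.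
Qed.

(** The rotation [e = e1 Cconj e2] aligns [e b_n] with [a_n], so that
    [|a_n + e b_n| = |a_n| + |b_n|] and one application of Caratheodory's bound controls the sum. *)
Lemma coefficient_bound (alpha beta : R) (f : C -> C) (a b : nat -> C) (n : nat) :
  0 <= alpha -> W0H alpha beta f -> has_coefficients f a b -> (2 <= n)%nat ->
  Cmod (a n) + Cmod (b n) <= 2 * (1 - beta) / (INR n * (1 + alpha * (INR n - 1))).
Proof.
  intros Ha HW Hco Hn.
  destruct (W0H_expansion _ _ _ _ _ HW Hco) as [DA [DB [_ HP]]].
  destruct n as [|[|n]]; [lia|lia|].
  set (d := (INR (S n) + 1) * (1 + alpha * INR (S n))).
  assert (Hd : 1 <= d) by now apply growth_denominator_ge_1.
  replace (INR (S (S n)) * (1 + alpha * (INR (S (S n)) - 1))) with d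
    by (unfold d; rewrite (S_INR (S n)); ring).
  destruct (unit_direction (a (S (S n)))) as [e1 [He1 E1]].
  destruct (unit_direction (b (S (S n)))) as [e2 [He2 E2]].
  set (e := (e1 * Cconj e2)%C).
  assert (He : Cmod e = 1) by (unfold e; rewrite Cmod_mult, Cmod_conj, He1, He2; ring).
  assert (Hx : Cmod (a (S (S n))) + Cmod (b (S (S n))) = Cmod (a (S (S n)) + e * b (S (S n)))%C).
  { rewrite E1, E2 at 2. unfold e.
    replace (_ + _)%C with (RtoC (Cmod (a (S (S n)))) * e1
      + RtoC (Cmod (b (S (S n)))) * e1 * (e2 * Cconj e2))%C by cring.
    rewrite Cconj_unit, Cmult_1_r, <- Cmult_plus_distr_r, <- RtoC_plus by exact He2.
    rewrite Cmod_mult, He1, Cmod_R, Rmult_1_r, Rabs_pos_eq; [reflexivity|].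
    generalize (Cmod_ge_0 (a (S (S n)))) (Cmod_ge_0 (b (S (S n)))). lra. }
  rewrite Hx.
  assert (Hb : d * Cmod (a (S (S n)) + e * b (S (S n)))%C <= 2 * (1 - beta)).
  { apply (le_of_mult_pow_le _ _ (S n)). intros rho Hrho.
    destruct (dilated_positive alpha beta rho _ _ e Hrho DA DB He HP) as [Hs Hpos].
    assert (H0 := dilated_at_0 alpha beta rho a b e).
    generalize (caratheodory_coefficient _ _ (S n) Hs H0 Hpos (Nat.lt_0_succ n)).
    unfold Cdelta, weighted_coef; simpl Nat.eqb; cbv iota; simpl full_coef. fold d.
    replace (_ * _)%C with (RtoC d * (a (S (S n)) + e * b (S (S n))) * RtoC rho ^ S n)%C by cring.
    rewrite !Cmod_mult, Cmod_pow, !Cmod_R, !Rabs_pos_eq by lra. exact (fun h => h). }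
  apply Rmult_le_reg_r with d; [lra|]. unfold Rdiv. rewrite Rmult_assoc, Rinv_l by lra. lra.
Qed.

Lemma growth_bound (alpha beta : R) (f : C -> C) (a b : nat -> C) (z : C) :
  0 <= alpha -> W0H alpha beta f -> has_coefficients f a b -> unit_disk z ->
  Cmod z * growth alpha beta (sqrt (Cmod z)) <= Cmod (f z).
Proof.
  intros Ha HW Hco Hz.
  destruct (W0H_expansion _ _ _ _ _ HW Hco) as [DA [DB [Ef HP]]].
  set (A := full_coef 1 a) in *. set (B := full_coef 0 b) in *.
  set (G := Cpseries B z).
  destruct (unit_direction G) as [e0 [He0 EG]].
  (* The estimate is pointwise, so [e] may depend on [z]: with [G = |G| e0] this choice gives
     [e G = Cconj G]. *)
  set (e := (Cconj e0 * Cconj e0)%C).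
  assert (He : Cmod e = 1) by (unfold e; rewrite Cmod_mult, Cmod_conj, He0; ring).
  assert (Hc : Cconj G = (e * G)%C).
  { rewrite EG. rewrite Cmult_conj. unfold e.
    replace (Cconj e0 * Cconj e0 * (Cmod G * e0))%C with (Cmod G * Cconj e0 * (e0 * Cconj e0))%C by cring.
    rewrite Cconj_unit by exact He0.
    replace (Cconj (Cmod G)) with (RtoC (Cmod G)) by (unfold Cconj, RtoC; simpl; f_equal; ring).
    cring. }
  destruct (unit_direction z) as [u [Hu Ez]].
  set (r := Cmod z) in *. unfold unit_disk in Hz. fold r in Hz.
  assert (Hr : 0 <= r) by apply Cmod_ge_0.
  set (rho := sqrt r). assert (Hrho0 : 0 <= rho) by apply sqrt_pos.
  assert (Hrr : rho * rho = r) by now apply sqrt_sqrt.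
  assert (Hrho : 0 <= rho < 1) by (split; [assumption|nra]).
  set (w := (RtoC rho * u)%C).
  assert (Hw : Cmod w = rho) by (unfold w; rewrite Cmod_mult, Cmod_R, Hu, Rabs_pos_eq; lra).
  assert (Ew : (RtoC rho * w)%C = z).
  { unfold w. rewrite Ez, <- Hrr, RtoC_mult. cring. }
  destruct (dilated_positive alpha beta rho _ _ e Hrho DA DB He HP) as [Hs Hpos].
  assert (H0 := dilated_at_0 alpha beta rho a b e).
  assert (HG := growth_lower alpha (1 - beta) _ w Ha Hs H0 Hpos ltac:(lra)).
  rewrite Hw in HG.
  assert (SAz := disk_summable_at A z DA Hz). assert (SBz := disk_summable_at B z DB Hz).
  set (c := fun n => (A n + e * B n)%C).
  assert (Scz : abs_summable (fun n => c n * z ^ n)%C).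
  { apply (abs_summable_ext (fun n => A n * z ^ n + e * (B n * z ^ n))%C).
    - intros n. unfold c. cring.
    - apply abs_summable_plus; [exact SAz|exact (abs_summable_scal e _ SBz)]. }
  assert (EF : f z = CSeries (fun n => c n * z ^ n)%C).
  { rewrite (Ef z Hz). fold G. rewrite Hc.
    rewrite (CSeries_ext _ (fun n => A n * z ^ n + e * (B n * z ^ n))%C)
      by (intros n; unfold c; cring).
    rewrite CSeries_plus, CSeries_scal; trivial. now apply abs_summable_scal. }
  destruct (Req_dec r 0) as [Hr0|Hr0]; [rewrite Hr0, Rmult_0_l; apply Cmod_ge_0|].
  assert (Hz0 : z <> RtoC 0) by (intros E; apply Hr0; unfold r; rewrite E; apply Cmod_0).
  set (v := fun n => (c (S n) * z ^ n)%C).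
  assert (Sv : abs_summable v).
  { apply (abs_summable_ext (fun n => / z * (c (S n) * z ^ S n))%C).
    - intros n. unfold v. rewrite Cpow_S. field. exact Hz0.
    - apply (abs_summable_scal (/ z) (fun n => c (S n) * z ^ S n)%C).
      now apply (abs_summable_incr (fun n => c n * z ^ n)%C). }
  assert (EFv : f z = (z * CSeries v)%C).
  { rewrite EF, CSeries_incr by exact Scz.
    rewrite <- CSeries_scal by exact Sv.
    replace (c 0%nat * z ^ 0)%C with (RtoC 0) by (unfold c, A, B; simpl; cring).
    rewrite Cplus_0_l. apply CSeries_ext. intros n. unfold v. rewrite Cpow_S. cring. }
  rewrite EFv, Cmod_mult. fold r. apply Rmult_le_compat_l; [exact Hr|].
  eapply Rle_trans; [|apply Rle_trans with (2 := re_le_Cmod _); apply Rle_abs].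
  unfold growth.
  (* The division by [D_(n+1)] cancels the weight, and [rho^n w^n] recombines to [z^n]; only the
     [- beta] at index 0 remains besides [F z / z]. *)
  rewrite (CSeries_ext _ (fun n => v n + Cdelta 0 (RtoC (- beta)) n)%C) in HG.
  - rewrite CSeries_plus, CSeries_Cdelta in HG; [|exact Sv|apply abs_summable_Cdelta].
    set (x := CSeries v) in *.
    change (Re (x + RtoC (- beta))%C) with (Re x + - beta) in HG. fold rho. lra.
  - intros n. cbv beta. unfold v, c, weighted_coef, Cdelta. rewrite <- Ew, Cpow_mult_l.
    fold A B.
    set (d := (INR n + 1) * (1 + alpha * INR n)).
    assert (Hd : 1 <= d) by now apply growth_denominator_ge_1.
    assert (Hdc : RtoC d <> RtoC 0) by (intros E; apply RtoC_inj in E; lra).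
    destruct n as [|n]; simpl Nat.eqb; cbv iota.
    + assert (E1 : RtoC d = RtoC 1) by (unfold d; simpl; f_equal; ring).
      rewrite E1. simpl Cpow. field.
    + field. exact Hdc.
Qed.

(** * The growth function at the boundary *)

(** Serves to show that the radius of convergence is exactly 1, which places Abel's theorem at the
    point 1. *)
Lemma growth_coef_ratio (alpha : R) : 0 <= alpha ->
  is_lim_seq (fun n => Rabs (growth_coef alpha (S n) / growth_coef alpha n)) 1.
Proof.
  (* Index 0 is skipped, since [half_plane_coef] has another form there. The ratio is then
     [d1 / d2], and its lower bound reduces to [(n + 1) (1 + alpha (n + 2)) = d1 - 1]. *)
  intros Ha. apply is_lim_seq_incr_1.
  apply is_lim_seq_le_le with (fun n => 1 - 2 * / INR (S (S (S n)) )) (fun _ => 1).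
  - intros n. unfold growth_coef, half_plane_coef. simpl Nat.eqb; cbv iota.
    assert (H1 := growth_denominator_ge_1 alpha (S n) Ha).
    assert (H2 := growth_denominator_ge_1 alpha (S (S n)) Ha).
    rewrite !S_INR in *.
    set (d1 := (INR n + 1 + 1) * (1 + alpha * (INR n + 1))) in *.
    set (d2 := (INR n + 1 + 1 + 1) * (1 + alpha * (INR n + 1 + 1))) in *.
    assert (Hp : (-1) ^ S n <> 0) by (apply pow_nonzero; lra).
    rewrite <- (tech_pow_Rmult (-1) (S n)).
    set (q := (-1) ^ S n) in *. clearbody q.
    replace (2 * (-1 * q) / d2 / (2 * q / d1)) with (- (d1 / d2))
      by (field; repeat split; (assumption || lra)).
    assert (Hn := pos_INR n).
    assert (Hd : 0 <= d1 / d2) by (apply Rmult_le_pos; [lra|left; apply Rinv_0_lt_compat; lra]).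
    rewrite Rabs_Ropp, Rabs_pos_eq by exact Hd.
    assert (Han : 0 <= alpha * INR n) by now apply Rmult_le_pos.
    split.
    + apply Rmult_le_reg_r with d2; [lra|].
      replace (d1 / d2 * d2) with d1 by (field; lra).
      replace ((1 - 2 * / (INR n + 1 + 1 + 1)) * d2) with ((INR n + 1) * (1 + alpha * (INR n + 1 + 1)))
        by (unfold d2; field; lra).
      unfold d1. nra.
    + apply Rmult_le_reg_r with d2; [lra|].
      replace (d1 / d2 * d2) with d1 by (field; lra). unfold d1, d2. nra.
  - replace (Finite 1) with (Finite (1 - 2 * 0)) by (f_equal; ring).
    apply is_lim_seq_minus'; [apply is_lim_seq_const|].
    apply (is_lim_seq_scal_l _ 2 0).
    apply (is_lim_seq_ext (fun n => / INR (n + 3))); [intros n; do 2 f_equal; lia|].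
    apply (proj1 (is_lim_seq_incr_n (fun n => / INR n) 3 0)).
    apply (is_lim_seq_inv INR p_infty); [apply is_lim_seq_INR|easy].
  - apply is_lim_seq_const.
Qed.

Lemma growth_coef_neq_0 (alpha : R) (n : nat) : 0 <= alpha -> growth_coef alpha n <> 0.
Proof.
  intros Ha. assert (H := growth_denominator_ge_1 alpha n Ha). unfold growth_coef.
  apply Rmult_integral_contrapositive. split; [|apply Rinv_neq_0_compat; lra].
  unfold half_plane_coef. destruct (Nat.eqb n 0); [lra|].
  apply Rmult_integral_contrapositive. split; [lra|apply pow_nonzero; lra].
Qed.

Lemma CV_radius_growth_coef (alpha : R) : 0 <= alpha -> CV_radius (growth_coef alpha) = 1.
Proof.
  intros Ha. rewrite (CV_radius_finite_DAlembert _ 1); [now rewrite Rinv_1| |lra|].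
  - intros n. now apply growth_coef_neq_0.
  - now apply growth_coef_ratio.
Qed.

(** For [alpha = 0] the terms decay only like [1 / n], so convergence comes from Leibniz's
    criterion. *)
Lemma ex_series_alternating (alpha : R) : 0 <= alpha ->
  ex_series (fun n => (-1) ^ n / ((INR n + 1) * (1 + alpha * INR n))).
Proof.
  intros Ha. set (U := fun n => / ((INR n + 1) * (1 + alpha * INR n))).
  destruct (alternated_series U) as [l Hl].
  - intros n. unfold U. generalize (growth_denominator_ge_1 alpha n Ha) (pos_INR n).
    intros H1 Hn. apply Rinv_le_contravar; [lra|]. rewrite S_INR.
    assert (0 <= alpha * INR n) by now apply Rmult_le_pos. nra.
  - apply is_lim_seq_Reals.
    apply is_lim_seq_le_le with (fun _ => 0) (fun n => / INR (S n)).
    + intros n. unfold U. generalize (growth_denominator_ge_1 alpha n Ha) (pos_INR n).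
      intros H1 Hn. split; [left; apply Rinv_0_lt_compat; lra|].
      rewrite S_INR. apply Rinv_le_contravar; [lra|].
      assert (0 <= alpha * INR n) by now apply Rmult_le_pos. nra.
    + apply is_lim_seq_const.
    + apply (is_lim_seq_incr_1 (fun n => / INR n) 0).
      apply (is_lim_seq_inv INR p_infty); [apply is_lim_seq_INR|easy].
  - exists l. apply is_series_Reals. intros eps He. destruct (Hl eps He) as [N HN].
    exists N. intros n Hn. specialize (HN n Hn). exact HN.
Qed.

Lemma ex_series_growth_coef (alpha : R) : 0 <= alpha -> ex_series (growth_coef alpha).
Proof.
  intros Ha. apply ex_series_incr_1.
  assert (H := proj1 (ex_series_incr_1 _) (ex_series_alternating alpha Ha)).
  apply (ex_series_ext (fun n => 2 * ((-1) ^ S n / ((INR (S n) + 1) * (1 + alpha * INR (S n)))))).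
  - intros n. unfold growth_coef, half_plane_coef. simpl Nat.eqb; cbv iota. unfold Rdiv. rring.
  - exact (ex_series_scal_l 2 _ H).
Qed.

(** The denominator [alpha n^2 + n (1 - alpha)] is [D_n], and index [n + 1] here matches index
    [n + 2] there. *)
Lemma growth_at_1 (alpha beta : R) : 0 <= alpha ->
  growth alpha beta 1 = radius_rhs alpha beta.
Proof.
  intros Ha. unfold growth, radius_rhs, Series2, PSeries.
  rewrite (Series_ext _ (growth_coef alpha)) by (intros n; rewrite pow1; ring).
  rewrite Series_incr_1 by now apply ex_series_growth_coef.
  replace (growth_coef alpha 0) with 1
    by (unfold growth_coef, half_plane_coef; simpl; field; lra).
  rewrite Rmult_plus_distr_l, <- !Series_scal_l.
  rewrite (Series_ext (fun n => (1 - beta) * growth_coef alpha (S n))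
    (fun k => 2 * ((-1) ^ (k + 2 - 1) * (1 - beta)
      / (alpha * INR (k + 2) ^ 2 + INR (k + 2) * (1 - alpha))))); [ring|].
  intros n. unfold growth_coef, half_plane_coef. simpl Nat.eqb; cbv iota.
  replace (n + 2 - 1)%nat with (S n) by lia. rewrite plus_INR, S_INR. simpl (INR 2).
  assert (Hd := growth_denominator_ge_1 alpha (S n) Ha). rewrite S_INR in Hd.
  replace (alpha * (INR n + (1 + 1)) ^ 2 + (INR n + (1 + 1)) * (1 - alpha))
    with ((INR n + 1 + 1) * (1 + alpha * (INR n + 1))) by ring.
  field. split; intros E; rewrite E in Hd; lra.
Qed.

Lemma growth_left_limit (alpha beta : R) : 0 <= alpha ->
  filterlim (growth alpha beta) (at_left 1) (locally (radius_rhs alpha beta)).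
Proof.
  intros Ha. rewrite <- growth_at_1 by exact Ha.
  assert (HR := CV_radius_growth_coef alpha Ha).
  generalize (Abel (growth_coef alpha)). rewrite HR. simpl. intros H.
  assert (HA : filterlim (PSeries (growth_coef alpha)) (at_left 1)
    (locally (PSeries (growth_coef alpha) 1))).
  { apply H; [lra|exact I|]. apply ex_pseries_R.
    apply (ex_series_ext (growth_coef alpha)); [intros n; rewrite pow1; rring|].
    now apply ex_series_growth_coef. }
  unfold growth.
  apply (filterlim_comp _ _ _ (PSeries (growth_coef alpha)) (fun y => beta + (1 - beta) * y)
    _ _ _ HA).
  apply (continuity_pt_filterlim (fun y => beta + (1 - beta) * y)). reg.
Qed.

(** * The Bohr radius *)

Lemma term_le_Series (x : nat -> R) (n : nat) :
  (forall k, 0 <= x k) -> ex_series x -> x n <= Series x.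
Proof.
  intros Hx Hs. eapply Rle_trans; [|now apply (sum_n_le_Series x n)].
  destruct n; [rewrite sum_O; lra|]. rewrite sum_Sn.
  assert (0 <= sum_n x n); [|unfold plus; simpl; lra].
  rewrite <- (Rmult_0_r (INR (S n))), <- sum_n_const. now apply sum_n_m_le.
Qed.

Lemma Series_lt (x y : nat -> R) (n : nat) :
  (forall k, 0 <= x k <= y k) -> ex_series y -> x n < y n -> Series x < Series y.
Proof.
  intros H Hy Hn.
  assert (Hx : ex_series x).
  { apply (ex_series_le (V := R_CompleteNormedModule) _ y); [|exact Hy].
    intros k. unfold norm; simpl; unfold abs; simpl. rewrite Rabs_pos_eq; apply H. }
  assert (Hd : ex_series (fun k => y k - x k)) by exact (ex_series_minus y x Hy Hx).
  assert (Hp : forall k, 0 <= y k - x k) by (intros k; generalize (H k); lra).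
  generalize (term_le_Series _ n Hp Hd).
  rewrite Series_minus by assumption. lra.
Qed.

Lemma coef_denominator_ge_1 (alpha : R) (k : nat) : 0 <= alpha ->
  1 <= INR (k + 2) * (1 + alpha * (INR (k + 2) - 1)).
Proof.
  intros Ha. generalize (growth_denominator_ge_1 alpha (S k) Ha).
  rewrite plus_INR, S_INR. simpl (INR 2).
  replace (INR k + (1 + 1)) with (INR k + 1 + 1) by ring.
  replace (INR k + 1 + 1 - 1) with (INR k + 1) by ring. lra.
Qed.

Lemma admissible_ex_series (phi : nat -> R -> R) (r : R) : admissible phi -> 0 <= r < 1 ->
  ex_series (fun k => phi (k + 2)%nat r).
Proof.
  intros [_ [_ [_ Hcv]]] Hr. destruct (Hcv r Hr) as [d Hd].
  apply CVU_CVS_dom in Hd.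
  destruct (Hd r) as [l Hl].
  { split; [exact Hr|]. rewrite Rminus_diag, Rabs_R0. apply cond_pos. }
  apply ex_series_ext with (fun k => phi (2 + k)%nat r).
  - intros n. now rewrite Nat.add_comm.
  - apply (ex_series_incr_n (fun n => phi n r) 2). now exists l.
Qed.

Lemma lhs_term_bounds (alpha : R) (phi : nat -> R -> R) (r : R) (k : nat) :
  0 <= alpha -> admissible phi -> 0 <= r < 1 ->
  0 <= phi (k + 2)%nat r / (INR (k + 2) * (1 + alpha * (INR (k + 2) - 1))) <= phi (k + 2)%nat r.
Proof.
  intros Ha [Hpos _] Hr. specialize (Hpos (k + 2)%nat r Hr).
  assert (Hd := coef_denominator_ge_1 alpha k Ha).
  split.
  - apply Rmult_le_pos; [exact Hpos|left; apply Rinv_0_lt_compat; lra].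
  - rewrite <- (Rabs_pos_eq (phi (k + 2)%nat r)) at 2 by exact Hpos.
    eapply Rle_trans; [apply Rle_abs|]. now apply Rabs_div_ge_1.
Qed.

Lemma ex_series_lhs (alpha : R) (phi : nat -> R -> R) (r : R) :
  0 <= alpha -> admissible phi -> 0 <= r < 1 ->
  ex_series (fun k => phi (k + 2)%nat r / (INR (k + 2) * (1 + alpha * (INR (k + 2) - 1)))).
Proof.
  intros Ha Hphi Hr.
  apply (ex_series_le (V := R_CompleteNormedModule) _ (fun k => phi (k + 2)%nat r));
    [|now apply admissible_ex_series].
  intros k. unfold norm; simpl; unfold abs; simpl.
  rewrite Rabs_pos_eq; now apply lhs_term_bounds.
Qed.

Lemma lhs_term_le (alpha : R) (phi : nat -> R -> R) (r s : R) (k : nat) :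
  0 <= alpha -> admissible phi -> 0 <= r -> r <= s -> s < 1 ->
  0 <= phi (k + 2)%nat r / (INR (k + 2) * (1 + alpha * (INR (k + 2) - 1)))
    <= phi (k + 2)%nat s / (INR (k + 2) * (1 + alpha * (INR (k + 2) - 1))).
Proof.
  intros Ha Hphi H0 Hrs H1. split; [apply lhs_term_bounds; trivial; lra|].
  assert (Hd := coef_denominator_ge_1 alpha k Ha).
  apply Rmult_le_compat_r; [left; apply Rinv_0_lt_compat; lra|].
  now apply (proj1 (proj2 Hphi)).
Qed.

Lemma lhs_series_le (alpha : R) (phi : nat -> R -> R) (r s : R) :
  0 <= alpha -> admissible phi -> 0 <= r -> r <= s -> s < 1 ->
  Series2 (fun n => phi n r / (INR n * (1 + alpha * (INR n - 1))))
  <= Series2 (fun n => phi n s / (INR n * (1 + alpha * (INR n - 1)))).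
Proof.
  intros Ha Hphi H0 Hrs H1. apply Series_le.
  - intros k. now apply lhs_term_le.
  - apply ex_series_lhs; trivial; lra.
Qed.

Lemma radius_lhs_le (alpha beta : R) (phi : nat -> R -> R) (r s : R) :
  0 <= alpha -> beta < 1 -> admissible phi -> 0 <= r -> r <= s -> s < 1 ->
  radius_lhs alpha beta phi r <= radius_lhs alpha beta phi s.
Proof.
  intros Ha Hb Hphi H0 Hrs H1. unfold radius_lhs.
  assert (r * phi 0%nat r <= s * phi 0%nat s).
  { apply Rmult_le_compat; trivial.
    - apply Hphi. lra.
    - now apply (proj1 (proj2 Hphi)). }
  assert (HS := lhs_series_le alpha phi r s Ha Hphi H0 Hrs H1).
  apply Rplus_le_compat; [assumption|]. apply Rmult_le_compat_l; [lra|exact HS].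
Qed.

Lemma radius_lhs_nonneg (alpha beta : R) (phi : nat -> R -> R) (r : R) :
  0 <= alpha -> beta < 1 -> admissible phi -> 0 <= r < 1 -> 0 <= radius_lhs alpha beta phi r.
Proof.
  intros Ha Hb Hphi Hr. unfold radius_lhs.
  assert (0 <= r * phi 0%nat r) by (apply Rmult_le_pos; [lra|now apply Hphi]).
  assert (0 <= Series2 (fun n => phi n r / (INR n * (1 + alpha * (INR n - 1))))).
  { eapply Rle_trans; [|apply (term_le_Series _ 0)].
    - now apply lhs_term_bounds.
    - intros k. now apply lhs_term_bounds.
    - now apply ex_series_lhs. }
  nra.
Qed.

(** Strictness comes either from the factor [r] in front of a positive [phi 0] or from a single
    strictly increasing term of the series. *)
Lemma radius_lhs_lt (alpha beta : R) (phi : nat -> R -> R) (r s : R) :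
  0 <= alpha -> beta < 1 -> admissible phi ->
  (forall t, 0 < t < 1 -> 0 < phi 0%nat t) \/
  (exists n, (2 <= n)%nat /\ strictly_increasing_on_01 (phi n)) ->
  0 < r -> r < s -> s < 1 ->
  radius_lhs alpha beta phi r < radius_lhs alpha beta phi s.
Proof.
  intros Ha Hb Hphi Hst H0 Hrs H1. unfold radius_lhs.
  assert (Hr : 0 <= r) by lra. assert (Hrs' : r <= s) by lra.
  assert (Hm := proj1 (proj2 Hphi) 0%nat r s Hr Hrs' H1).
  assert (H00 : 0 <= phi 0%nat r) by (apply Hphi; lra).
  assert (HS := lhs_series_le alpha phi r s Ha Hphi Hr Hrs' H1).
  destruct Hst as [Hp|[n [Hn Hinc]]].
  - assert (0 < phi 0%nat s) by (apply Hp; lra).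
    apply Rplus_lt_le_compat; [nra|]. apply Rmult_le_compat_l; [lra|exact HS].
  - apply Rplus_le_lt_compat; [apply Rmult_le_compat; lra|].
    apply Rmult_lt_compat_l; [lra|]. apply (Series_lt _ _ (n - 2)).
    + intros k. now apply lhs_term_le.
    + apply ex_series_lhs; trivial; lra.
    + replace (n - 2 + 2)%nat with n by lia.
      assert (Hd := coef_denominator_ge_1 alpha (n - 2) Ha).
      replace (n - 2 + 2)%nat with n in Hd by lia.
      apply Rmult_lt_compat_r; [apply Rinv_0_lt_compat; lra|]. now apply Hinc.
Qed.

(** * Existence of the root *)

(** The [phi n] are controlled only on [[0, 1)]. Composing with the projection onto [[0, b]] gives
    functions continuous on the whole line, to which the intermediate value theorem applies. *)
Definition clamp (b x : R) : R := Rmax 0 (Rmin x b).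

Lemma clamp_range (b x : R) : 0 <= b -> 0 <= clamp b x <= b.
Proof.
  intros Hb. unfold clamp, Rmax, Rmin. repeat destruct Rle_dec; lra.
Qed.

Lemma clamp_id (b x : R) : 0 <= x <= b -> clamp b x = x.
Proof.
  intros Hb. unfold clamp, Rmax, Rmin. repeat destruct Rle_dec; lra.
Qed.

Lemma clamp_lipschitz (b x y : R) : Rabs (clamp b y - clamp b x) <= Rabs (y - x).
Proof.
  unfold clamp, Rmax, Rmin. repeat destruct Rle_dec; split_Rabs; lra.
Qed.

(** At a clamped value 0 only a right limit is available; it suffices because nearby clamped values
    are nonnegative. *)
Lemma continuity_pt_clamp (psi : R -> R) (b x : R) : 0 < b < 1 ->
  filterlim psi (at_right 0) (locally (psi 0)) ->
  (forall r, 0 < r < 1 -> ex_derive psi r) ->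
  continuity_pt (fun y => psi (clamp b y)) x.
Proof.
  intros Hb H0 Hd.
  assert (Hx := clamp_range b x ltac:(lra)).
  assert (Hloc : forall eps : R, 0 < eps -> exists d, 0 < d /\
    forall c, 0 <= c -> Rabs (c - clamp b x) < d -> Rabs (psi c - psi (clamp b x)) < eps).
  { intros eps He. destruct (Req_dec (clamp b x) 0) as [E|E].
    - rewrite E.
      destruct (H0 (ball (psi 0) (mkposreal eps He))) as [d Hd']; [now exists (mkposreal eps He)|].
      exists d; split; [apply cond_pos|]. intros c Hc Hcd.
      destruct (Req_dec c 0) as [->|Hc0]; [rewrite Rminus_diag, Rabs_R0; exact He|].
      apply Hd'; [exact Hcd|lra].
    - assert (Hc : continuity_pt psi (clamp b x)).
      { apply continuity_pt_filterlim, (ex_derive_continuous psi), Hd. lra. }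
      destruct (Hc eps He) as [d [Hd1 Hd2]]. exists d; split; [exact Hd1|].
      intros c _ Hcd. destruct (Req_dec (clamp b x) c) as [<-|Hne].
      + rewrite Rminus_diag, Rabs_R0; exact He.
      + apply Hd2. split; [split; [exact I|exact Hne]|exact Hcd]. }
  intros eps He. destruct (Hloc eps He) as [d [Hd1 Hd2]].
  exists d; split; [exact Hd1|]. intros y [_ Hy].
  apply Hd2; [apply clamp_range; lra|].
  eapply Rle_lt_trans; [apply clamp_lipschitz|exact Hy].
Qed.

(** The Weierstrass M-test: the tails of [M] bound those of [T] uniformly. *)
Lemma continuity_pt_Series (T : nat -> R -> R) (M : nat -> R) (x : R) :
  (forall k y, 0 <= T k y <= M k) -> ex_series M ->
  (forall k y, continuity_pt (T k) y) ->
  continuity_pt (fun y => Series (fun k => T k y)) x.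
Proof.
  intros HT HM Hc.
  apply (CVU_cont_open (fun N y => sum_n (fun k => T k y) N) (fun _ => True)); trivial.
  - apply open_true.
  - intros eps. destruct (is_series_eps _ _ eps (Series_correct _ HM) (cond_pos eps)) as [N HN].
    exists N. intros n Hn y _. specialize (HN n Hn).
    change (Rabs (sum_n (fun k => T k y) n - Series (fun k => T k y)) < eps).
    assert (Ht : ex_series (fun k => T k y)).
    { apply (ex_series_le (V := R_CompleteNormedModule) _ M); [|exact HM].
      intros k. unfold norm; simpl; unfold abs; simpl. rewrite Rabs_pos_eq; apply HT. }
    rewrite (Series_incr_n _ (S n) ltac:(lia) Ht).
    rewrite (Series_incr_n _ (S n) ltac:(lia) HM) in HN. simpl pred in *.
    rewrite sum_n_Reals in *.
    assert (Hs := proj1 (ex_series_incr_n M (S n)) HM).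
    assert (Hts := proj1 (ex_series_incr_n _ (S n)) Ht).
    assert (H1 : 0 <= Series (fun k => T (S n + k)%nat y)).
    { eapply Rle_trans; [|apply (term_le_Series _ 0); [intros k; apply HT|exact Hts]]. apply HT. }
    assert (H2 : Series (fun k => T (S n + k)%nat y) <= Series (fun k => M (S n + k)%nat)).
    { apply Series_le; [intros k; apply HT|exact Hs]. }
    apply Rabs_def2 in HN. apply Rabs_def1; lra.
  - intros n y _. induction n as [|n IH].
    + apply (continuity_pt_ext (T 0%nat)); [intros t; now rewrite sum_O|apply Hc].
    + apply (continuity_pt_ext (fun t => sum_n (fun k => T k t) n + T (S n) t)).
      * intros t. now rewrite sum_Sn.
      * now apply continuity_pt_plus.
Qed.

Lemma radius_lhs_at_0 (alpha beta : R) (phi : nat -> R -> R) : beta < 1 ->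
  Series2 (fun n => phi n 0 / (INR n * (1 + alpha * (INR n - 1))))
  < 1 / (2 * (1 - beta))
    + Series2 (fun n => (-1) ^ (n - 1) / (alpha * INR n ^ 2 + INR n * (1 - alpha))) ->
  radius_lhs alpha beta phi 0 < radius_rhs alpha beta.
Proof.
  intros Hb H. unfold radius_lhs, radius_rhs. rewrite Rmult_0_l, Rplus_0_l.
  replace (Series2 (fun n => (-1) ^ (n - 1) * (1 - beta) / (alpha * INR n ^ 2 + INR n * (1 - alpha))))
    with ((1 - beta) * Series2 (fun n => (-1) ^ (n - 1) / (alpha * INR n ^ 2 + INR n * (1 - alpha)))).
  - apply (Rmult_lt_compat_l (2 * (1 - beta))) in H; [|lra].
    rewrite Rmult_plus_distr_l in H.
    replace (2 * (1 - beta) * (1 / (2 * (1 - beta)))) with 1 in H by (field; lra). lra.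
  - unfold Series2. rewrite <- Series_scal_l. apply Series_ext. intros k. unfold Rdiv. ring.
Qed.

Lemma radius_root_exists (alpha beta : R) (phi : nat -> R -> R) (b : R) :
  0 <= alpha -> beta < 1 -> admissible phi ->
  (forall n, (2 <= n)%nat -> filterlim (phi n) (at_right 0) (locally (phi n 0))) ->
  radius_lhs alpha beta phi 0 < radius_rhs alpha beta ->
  0 < b < 1 -> radius_rhs alpha beta <= radius_lhs alpha beta phi b ->
  exists rf, radius_root alpha beta phi rf.
Proof.
  intros Ha Hbeta Hphi Hright H0 Hb Hlb.
  set (D := fun k => INR (k + 2) * (1 + alpha * (INR (k + 2) - 1))).
  assert (Hcl : forall x, 0 <= clamp b x < 1) by (intros x; generalize (clamp_range b x); lra).
  assert (HT : continuity (fun x => Series (fun k => phi (k + 2)%nat (clamp b x) / D k))).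
  (* By monotonicity the values at [b] form a summable majorant on [[0, b]]. *)
  { intros x. apply (continuity_pt_Series _ (fun k => phi (k + 2)%nat b)).
    - intros k y. split; [now apply lhs_term_bounds|].
      eapply Rle_trans; [now apply lhs_term_bounds|].
      apply (proj1 (proj2 Hphi)); [apply Hcl| |lra]. apply clamp_range; lra.
    - apply admissible_ex_series; trivial; lra.
    - intros k y. unfold Rdiv.
      apply (continuity_pt_mult (fun x => phi (k + 2)%nat (clamp b x)) (fun _ => / D k)).
      + apply continuity_pt_clamp; trivial; [apply Hright; lia|].
        intros r Hr. now apply (proj1 (proj2 (proj2 Hphi))).
      + apply continuity_pt_const. now intros u v. }
  assert (HP : continuity (fun x => clamp b x * phi 0%nat (clamp b x))).
  { intros x. apply (continuity_pt_clamp (fun r => r * phi 0%nat r)); trivial.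
    (* Near 0, [phi 0] is bounded by its value at [b], so [r phi_0(r)] tends to 0. *)
    - rewrite Rmult_0_l. intros P [eps HP].
      assert (Hc := proj1 Hphi 0%nat b ltac:(lra)).
      assert (Hq : 0 < eps / (phi 0%nat b + 1)) by (apply Rdiv_lt_0_compat; [apply cond_pos|lra]).
      exists (mkposreal _ (Rmin_glb_lt _ _ _ Hq (proj1 Hb))). intros y Hy Hy0. apply HP.
      change (Rabs (y * phi 0%nat y - 0) < eps).
      change (Rabs (y - 0) < Rmin (eps / (phi 0%nat b + 1)) b) in Hy.
      rewrite Rminus_0_r in *. rewrite (Rabs_pos_eq y) in Hy by lra.
      assert (Hy1 : y < eps / (phi 0%nat b + 1)) by (eapply Rlt_le_trans; [exact Hy|apply Rmin_l]).
      assert (Hy2 : y < b) by (eapply Rlt_le_trans; [exact Hy|apply Rmin_r]).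
      assert (Hy3 := proj1 Hphi 0%nat y ltac:(lra)).
      rewrite Rabs_pos_eq by (apply Rmult_le_pos; lra).
      assert (phi 0%nat y <= phi 0%nat b) by (apply (proj1 (proj2 Hphi)); lra).
      apply (Rmult_lt_compat_r (phi 0%nat b + 1)) in Hy1; [|lra].
      unfold Rdiv in Hy1. rewrite Rmult_assoc, Rinv_l in Hy1 by lra. nra.
    - intros r Hr. apply (ex_derive_mult (fun x => x)); [apply ex_derive_id|].
      now apply (proj1 (proj2 (proj2 Hphi))). }
  set (F := fun x => clamp b x * phi 0%nat (clamp b x)
    + 2 * (1 - beta) * Series (fun k => phi (k + 2)%nat (clamp b x) / D k) - radius_rhs alpha beta).
  assert (HF : forall x, F x = radius_lhs alpha beta phi (clamp b x) - radius_rhs alpha beta)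
    by reflexivity.
  assert (HFc : continuity F).
  { apply continuity_minus; [apply continuity_plus; [exact HP|]|].
    - apply continuity_mult; [apply continuity_const; now intros u v|exact HT].
    - apply continuity_const. now intros u v. }
  assert (HF0 : F 0 < 0) by (rewrite HF, clamp_id; lra).
  assert (HFb : 0 <= F b) by (rewrite HF, clamp_id; lra).
  destruct (IVT_cor F 0 b HFc ltac:(lra)) as [z [Hz Ez]]; [nra|].
  exists z. rewrite HF, clamp_id in Ez by exact Hz.
  split; [|lra].
  split; [|lra]. destruct (Req_dec z 0) as [E|E]; [|lra].
  rewrite E in Ez. lra.
Qed.

(** * The distance to the boundary *)

Lemma left_limit_eps (f : R -> R) (l eps : R) : filterlim f (at_left 1) (locally l) -> 0 < eps ->
  exists rho, 0 <= rho < 1 /\ forall t, rho < t < 1 -> Rabs (f t - l) < eps.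
Proof.
  intros H He.
  destruct (H (ball l (mkposreal eps He))) as [d Hd]; [now exists (mkposreal eps He)|].
  generalize (cond_pos d); intros Hdp.
  exists (Rmax 0 (1 - d)). split.
  - split; [apply Rmax_l|]. apply Rmax_lub_lt; lra.
  - intros t Ht. generalize (Rmax_r 0 (1 - d)); intros Hm.
    apply (Hd t); [|lra]. change (Rabs (t - 1) < d). apply Rabs_def1; lra.
Qed.

Lemma filterlim_mult_left_limit (u v : R -> R) (x y : R) :
  filterlim u (at_left 1) (locally x) -> filterlim v (at_left 1) (locally y) ->
  filterlim (fun t => u t * v t) (at_left 1) (locally (x * y)).
Proof.
  intros Hu Hv. eapply filterlim_comp_2; [exact Hu|exact Hv|].
  exact (filterlim_mult (K := R_AbsRing) x y).
Qed.

Lemma left_limit_continuous (u : R -> R) : continuity_pt u 1 ->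
  filterlim u (at_left 1) (locally (u 1)).
Proof.
  intros H. apply continuity_pt_filterlim in H.
  eapply filterlim_filter_le_1; [|exact H]. apply filter_le_within.
Qed.

Lemma boundary_dist_ge (alpha beta : R) (f : C -> C) (a b : nat -> C) :
  0 <= alpha -> W0H alpha beta f -> has_coefficients f a b ->
  Rbar_le (Finite (radius_rhs alpha beta)) (boundary_dist f).
Proof.
  intros Ha HW Hco.
  assert (Hf0 : f (RtoC 0) = RtoC 0).
  { destruct (W0H_expansion _ _ _ _ _ HW Hco) as [DA [DB [Ef _]]].
    rewrite Ef by (unfold unit_disk; rewrite Cmod_0; lra). rewrite !Cpseries_at_0.
    unfold Cconj, RtoC, Cplus; simpl; f_equal; ring. }
  (* With [t = sqrt |z|], this is the left-hand side of [growth_bound]. *)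
  assert (Hlim : filterlim (fun t => t * t * growth alpha beta t) (at_left 1)
    (locally (1 * 1 * radius_rhs alpha beta))).
  { apply filterlim_mult_left_limit; [|now apply growth_left_limit].
    apply (left_limit_continuous (fun t => t * t)). reg. }
  rewrite !Rmult_1_l in Hlim.
  assert (Heps : forall eps, 0 < eps ->
    Rbar_le (Finite (radius_rhs alpha beta - eps)) (boundary_dist f)).
  { intros eps He. destruct (left_limit_eps _ _ eps Hlim He) as [rho [Hrho H]].
    set (X := fun x : R => exists z : C, rho < Cmod z < 1 /\ x = Cmod (f z - f (RtoC 0))%C).
    assert (HX : forall x, X x -> radius_rhs alpha beta - eps <= x).
    { intros x [z [Hz ->]]. rewrite Hf0.
      replace (f z - 0)%C with (f z) by cring.
      eapply Rle_trans; [|apply (growth_bound alpha beta f a b z); trivial; apply Hz].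
      set (r := Cmod z) in *. assert (Hs := sqrt_sqrt r ltac:(lra)).
      assert (Hp := sqrt_pos r).
      assert (Ht : rho < sqrt r < 1) by (split; nra).
      specialize (H (sqrt r) Ht). rewrite Hs in H. apply Rabs_def2 in H. lra. }
    destruct (Glb_Rbar_correct X) as [Hl Hg].
    assert (Hge : Rbar_le (Finite (radius_rhs alpha beta - eps)) (Glb_Rbar X)).
    { apply Hg. intros x Hx. now apply HX. }
    (* A point of the annulus makes the infimum finite, as [boundary_dist] requires. *)
    set (z0 := RtoC ((rho + 1) / 2)).
    assert (Hz0 : X (Cmod (f z0 - f (RtoC 0))%C)).
    { exists z0. split; [|reflexivity]. unfold z0. rewrite Cmod_R, Rabs_pos_eq; lra. }
    specialize (Hl _ Hz0).
    destruct (Glb_Rbar X) as [m| |] eqn:EG; simpl in Hl, Hge; try easy.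
    apply Rbar_le_trans with (Finite m); [exact Hge|].
    apply (proj1 (Lub_Rbar_correct _)). exists rho. split; [exact Hrho|exact EG]. }
  destruct (boundary_dist f) as [m| |]; simpl in *; trivial.
  - apply Rnot_lt_le; intros Hlt.
    specialize (Heps ((radius_rhs alpha beta - m) / 2)). lra.
  - apply (Heps 1). lra.
Qed.

Lemma ex_series_bohr (alpha beta : R) (phi : nat -> R -> R) (f : C -> C) (a b : nat -> C) (r : R) :
  0 <= alpha -> admissible phi -> W0H alpha beta f -> has_coefficients f a b -> 0 <= r < 1 ->
  ex_series (fun k => (Cmod (a (k + 2)%nat) + Cmod (b (k + 2)%nat)) * phi (k + 2)%nat r) /\
  r * phi 0%nat r + Series2 (fun n => (Cmod (a n) + Cmod (b n)) * phi n r)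
  <= radius_lhs alpha beta phi r.
Proof.
  intros Ha Hphi HW Hco Hr.
  set (t := fun k => phi (k + 2)%nat r / (INR (k + 2) * (1 + alpha * (INR (k + 2) - 1)))).
  assert (Hk : forall k, 0 <= (Cmod (a (k + 2)%nat) + Cmod (b (k + 2)%nat)) * phi (k + 2)%nat r
    <= 2 * (1 - beta) * t k).
  { intros k. assert (Hp := proj1 Hphi (k + 2)%nat r Hr).
    generalize (Cmod_ge_0 (a (k + 2)%nat)) (Cmod_ge_0 (b (k + 2)%nat)); intros H1 H2.
    split; [apply Rmult_le_pos; lra|].
    assert (Hc := coefficient_bound alpha beta f a b (k + 2) Ha HW Hco ltac:(lia)).
    apply Rle_trans with (2 * (1 - beta) / (INR (k + 2) * (1 + alpha * (INR (k + 2) - 1))) * phi (k + 2)%nat r).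
    - now apply Rmult_le_compat_r.
    - right. unfold t, Rdiv. ring. }
  assert (Ht : ex_series (fun k => 2 * (1 - beta) * t k))
    by exact (ex_series_scal_l (2 * (1 - beta)) _ (ex_series_lhs alpha phi r Ha Hphi Hr)).
  split.
  - apply (ex_series_le (V := R_CompleteNormedModule) _ (fun k => 2 * (1 - beta) * t k)); [|exact Ht].
    intros k. unfold norm; simpl; unfold abs; simpl. rewrite Rabs_pos_eq; apply Hk.
  - unfold radius_lhs. apply Rplus_le_compat_l. unfold Series2.
    fold t. rewrite <- Series_scal_l. now apply Series_le.
Qed.

(** * The extremal function *)

(** Equality in [coefficient_bound], with zero co-analytic part. *)
Definition extremal_coef (alpha beta : R) (n : nat) : C :=
  RtoC (2 * (1 - beta) / (INR n * (1 + alpha * (INR n - 1)))).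

Definition extremal (alpha beta : R) : C -> C :=
  Cpseries (full_coef 1 (extremal_coef alpha beta)).

Lemma extremal_coef_shift (alpha beta : R) (n : nat) :
  full_coef 1 (extremal_coef alpha beta) (S n)
  = RtoC (if Nat.eqb n 0 then 1 else 2 * (1 - beta) / ((INR n + 1) * (1 + alpha * INR n))).
Proof.
  destruct n as [|n]; [reflexivity|]. simpl Nat.eqb; cbv iota.
  unfold full_coef, extremal_coef. rewrite (S_INR (S n)). do 5 f_equal. ring.
Qed.

Lemma extremal_disk_summable (alpha beta : R) : 0 <= alpha -> 0 <= beta < 1 ->
  disk_summable (full_coef 1 (extremal_coef alpha beta)).
Proof.
  intros Ha Hb. apply disk_summable_radius. apply (proj1 (CV_radius_bounded _)).
  exists 2. intros [|n].
  - simpl full_coef. rewrite Cmod_0, Rmult_0_l, Rabs_R0. lra.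
  - rewrite extremal_coef_shift, Cmod_R, pow1, Rmult_1_r, Rabs_Rabsolu.
    destruct (Nat.eqb n 0); [rewrite Rabs_R1; lra|].
    eapply Rle_trans; [apply Rabs_div_ge_1; now apply growth_denominator_ge_1|].
    rewrite Rabs_pos_eq; lra.
Qed.

Lemma extremal_has_coefficients (alpha beta : R) : 0 <= alpha -> 0 <= beta < 1 ->
  has_coefficients (extremal alpha beta) (extremal_coef alpha beta) (fun _ => RtoC 0).
Proof.
  intros Ha Hb z Hz. assert (DA := extremal_disk_summable alpha beta Ha Hb).
  set (u := fun k => (extremal_coef alpha beta (k + 2) * z ^ (k + 2))%C).
  assert (Hu : is_series u (CSeries u)).
  { apply abs_summable_is_series.
    apply (abs_summable_ext (fun k => full_coef 1 (extremal_coef alpha beta) (2 + k) * z ^ (2 + k))%C).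
    - intros k. unfold u. now rewrite (Nat.add_comm k 2).
    - apply (ex_series_incr_n (fun n => Cmod (full_coef 1 (extremal_coef alpha beta) n * z ^ n)%C) 2).
      now apply disk_summable_at. }
  exists (CSeries u), (RtoC 0). repeat split.
  - exact Hu.
  - apply (is_series_ext (fun _ => RtoC 0)); [intros; cring|].
    apply is_series_pair; exact is_series_zero.
  - unfold extremal. rewrite (Cpseries_full_coef _ _ z (CSeries u)) by assumption.
    replace (Cconj 0) with (RtoC 0) by (unfold Cconj, RtoC; simpl; f_equal; ring). cring.
Qed.

(** Here [F' + alpha z F'' - beta] equals [(1 - beta) (1 + z) / (1 - z)]. The correction
    [2 beta - 1] at index 0 brings the constant term [2 (1 - beta)] of the geometric series to 1. *)
Lemma extremal_operator_positive (alpha beta : R) (z : C) :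
  0 <= alpha -> 0 <= beta < 1 -> unit_disk z ->
  0 < Re (Cpseries (weighted_coef alpha (full_coef 1 (extremal_coef alpha beta))) z) - beta.
Proof.
  intros Ha Hb Hz. unfold unit_disk in Hz.
  assert (Hg := Cgeom_abs_summable z Hz).
  unfold Cpseries.
  rewrite (CSeries_ext _ (fun n => RtoC (2 * (1 - beta)) * z ^ n + Cdelta 0 (RtoC (2 * beta - 1)) n)%C).
  - rewrite CSeries_plus, CSeries_Cdelta, CSeries_scal, CSeries_geom; trivial;
      [|now apply abs_summable_scal|apply abs_summable_Cdelta].
    generalize (Re_half_plane_map_lower z Hz). unfold Cdiv.
    set (x := (/ (1 - z))%C). intros H.
    assert (0 < (1 - Cmod z) / (1 + Cmod z))
      by (generalize (Cmod_ge_0 z); intros; apply Rdiv_lt_0_compat; lra).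
    change (Re (2 * x - 1)%C) with (Re (RtoC 2 * x)%C - 1) in H. rewrite re_scal_l in H.
    change (Re (RtoC (2 * (1 - beta)) * x + RtoC (2 * beta - 1))%C)
      with (Re (RtoC (2 * (1 - beta)) * x)%C + (2 * beta - 1)).
    rewrite re_scal_l. nra.
  - intros n. unfold weighted_coef. rewrite extremal_coef_shift, <- RtoC_mult.
    assert (Hd := growth_denominator_ge_1 alpha n Ha). unfold Cdelta.
    destruct n as [|n]; simpl Nat.eqb; cbv iota.
    + simpl Cpow. rewrite !Cmult_1_r, <- RtoC_plus. f_equal. simpl. ring.
    + rewrite Cplus_0_r. f_equal. f_equal. field.
      split; intros E; rewrite E in Hd; lra.
Qed.

Lemma extremal_W0H (alpha beta : R) : 0 <= alpha -> 0 <= beta < 1 ->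
  W0H alpha beta (extremal alpha beta).
Proof.
  intros Ha Hb. assert (DA := extremal_disk_summable alpha beta Ha Hb).
  assert (D0 : unit_disk (RtoC 0)) by (unfold unit_disk; rewrite Cmod_0; lra).
  assert (Hd := C_derive_Cpseries (extremal alpha beta) _ DA (fun z _ => eq_refl)).
  assert (Hg : forall z, C_derive (fun _ => RtoC 0) z = RtoC 0).
  { intros z. apply is_C_derive_unique. exact (is_derive_const (RtoC 0) z). }
  assert (Hg2 : forall z, C_derive (C_derive (fun _ => RtoC 0)) z = RtoC 0).
  { intros z. apply is_C_derive_unique. apply (is_derive_ext (fun _ => RtoC 0)).
    - intros t. now rewrite Hg.
    - exact (is_derive_const (RtoC 0) z). }
  exists (extremal alpha beta), (fun _ => RtoC 0). split.
  - split; [|split; [|split; [|split; [|split; [|split]]]]]; trivial.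
    + intros z Hz. eexists. now apply is_derive_Cpseries.
    + intros z Hz. eexists. exact (is_derive_const (RtoC 0) z).
    + intros z _. destruct (extremal alpha beta z) as [x y]. unfold Cconj, RtoC, Cplus; simpl; f_equal; ring.
    + exact (Cpseries_at_0 _).
    + rewrite Hd by exact D0. rewrite Cpseries_at_0.
      unfold Cderive_coef. simpl. cring.
  - intros z Hz. rewrite Hg, Hg2, Hd by exact Hz.
    rewrite (C_derive_Cpseries _ _ (disk_summable_derive _ DA) Hd z Hz).
    rewrite (proj2 (Cpseries_operator alpha _ z DA Hz)).
    replace (0 + RtoC alpha * z * 0)%C with (RtoC 0) by cring. rewrite Cmod_0.
    exact (extremal_operator_positive alpha beta z Ha Hb Hz).
Qed.

(** At [- r] the signs alternate and [F(- r) = - r growth(r)]. In [y], the extra [beta] at index 0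
    completes [1 - beta] to the coefficient 1 of [z]. *)
Lemma extremal_neg (alpha beta r : R) : 0 <= alpha -> 0 <= beta < 1 -> 0 <= r < 1 ->
  Cmod (extremal alpha beta (RtoC (- r))) = r * Rabs (growth alpha beta r).
Proof.
  intros Ha Hb Hr. assert (DA := extremal_disk_summable alpha beta Ha Hb).
  assert (Hz : Cmod (RtoC (- r)) < 1) by (rewrite Cmod_R, Rabs_Ropp, Rabs_pos_eq; lra).
  assert (HS := disk_summable_at _ _ DA Hz).
  unfold extremal, Cpseries. rewrite CSeries_incr by exact HS.
  assert (Hgc : ex_series (fun n => growth_coef alpha n * r ^ n)).
  { apply ex_pseries_R, CV_radius_inside. apply (CV_radius_of_bounded _ 2).
    - intros n. now apply growth_coef_bound.
    - rewrite Rabs_pos_eq; lra. }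
  set (y := fun n => (1 - beta) * (growth_coef alpha n * r ^ n) + (if Nat.eqb n 0 then beta else 0)).
  assert (E : forall n, (full_coef 1 (extremal_coef alpha beta) (S n) * RtoC (- r) ^ S n)%C
    = RtoC (- r * y n)).
  { intros n. rewrite extremal_coef_shift, <- RtoC_pow, <- RtoC_mult. f_equal.
    assert (Hd := growth_denominator_ge_1 alpha n Ha).
    unfold y, growth_coef, half_plane_coef. destruct n as [|n]; simpl Nat.eqb; cbv iota.
    - simpl. field.
    - replace (- r) with (-1 * r) by ring. rewrite Rpow_mult_distr, <- !(tech_pow_Rmult _ (S n)).
      field. split; intros E; rewrite E in Hd; lra. }
  assert (Hy : is_series y (growth alpha beta r)).
  { unfold growth. rewrite Rplus_comm. apply (is_series_plus (V := R_NormedModule)).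
    - apply (is_series_scal (V := R_NormedModule) (1 - beta)). now apply Series_correct.
    - generalize (is_series_Re _ _ (abs_summable_is_series _ (abs_summable_Cdelta 0 (RtoC beta)))).
      rewrite CSeries_Cdelta. apply is_series_ext. intros n. unfold Cdelta.
      destruct (Nat.eqb n 0); reflexivity. }
  rewrite (is_series_CSeries _ (RtoC (- r * growth alpha beta r))).
  - simpl full_coef. rewrite Cmult_0_l, Cplus_0_l, Cmod_R, Rabs_mult, Rabs_Ropp, (Rabs_pos_eq r); lra.
  - apply is_series_pair.
    + apply (is_series_ext (fun n => - r * y n)); [intros n; now rewrite E|].
      exact (is_series_scal (- r) y _ Hy).
    + apply (is_series_ext (fun n => 0)); [intros n; now rewrite E|]. exact is_series_zero.
Qed.

(** Every annulus contains points [- r] with [r] close to 1, where the modulus is close to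
    [radius_rhs]. *)
Lemma extremal_boundary_dist_le (alpha beta : R) : 0 <= alpha -> 0 <= beta < 1 ->
  0 <= radius_rhs alpha beta ->
  Rbar_le (boundary_dist (extremal alpha beta)) (Finite (radius_rhs alpha beta)).
Proof.
  intros Ha Hb Hpos. apply (proj2 (Lub_Rbar_correct _)).
  intros m [rho [Hrho HG]]. simpl. apply Rnot_lt_le; intros Hlt.
  assert (Hlim : filterlim (fun t => t * growth alpha beta t) (at_left 1)
    (locally (1 * radius_rhs alpha beta))).
  { apply filterlim_mult_left_limit; [|now apply growth_left_limit].
    apply (left_limit_continuous (fun t => t)). reg. }
  rewrite Rmult_1_l in Hlim.
  destruct (left_limit_eps _ _ (m - radius_rhs alpha beta) Hlim) as [s [Hs H]]; [lra|].
  set (r := (Rmax rho s + 1) / 2).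
  assert (Hm : Rmax rho s < 1) by (apply Rmax_lub_lt; lra).
  generalize (Rmax_l rho s) (Rmax_r rho s); intros H1 H2.
  specialize (H r ltac:(unfold r; lra)).
  assert (Hr : 0 <= r < 1) by (unfold r; lra).
  assert (Hle : m <= r * Rabs (growth alpha beta r)).
  { rewrite <- (extremal_neg alpha beta r Ha Hb Hr).
    match type of HG with Glb_Rbar ?X = _ => generalize (proj1 (Glb_Rbar_correct X)) end.
    rewrite HG. intros Hl. apply (Hl (Cmod (extremal alpha beta (RtoC (- r))))).
    exists (RtoC (- r)). split.
    - rewrite Cmod_R, Rabs_Ropp, Rabs_pos_eq by lra. unfold r; lra.
    - assert (E0 : extremal alpha beta (RtoC 0) = RtoC 0)
        by exact (Cpseries_at_0 _).
      rewrite E0. f_equal. cring. }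
  rewrite <- (Rabs_pos_eq r) in Hle at 1 by lra. rewrite <- Rabs_mult in Hle.
  (* The lower half, [- m < r * growth alpha beta r], rests on [0 <= radius_rhs alpha beta]. *)
  assert (Rabs (r * growth alpha beta r) < m); [|lra].
  apply Rabs_def2 in H. apply Rabs_def1; lra.
Qed.

Lemma extremal_bohr_sum (alpha beta : R) (phi : nat -> R -> R) (r : R) :
  0 <= alpha -> 0 <= beta < 1 ->
  r * phi 0%nat r
  + Series2 (fun n => (Cmod (extremal_coef alpha beta n) + Cmod (RtoC 0)) * phi n r)
  = radius_lhs alpha beta phi r.
Proof.
  intros Ha Hb. unfold radius_lhs, Series2. f_equal. rewrite <- Series_scal_l.
  apply Series_ext. intros k. assert (Hd := coef_denominator_ge_1 alpha k Ha).
  unfold extremal_coef. rewrite Cmod_0, Cmod_R, Rabs_pos_eq.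
  - unfold Rdiv. ring.
  - apply Rmult_le_pos; [lra|]. left; apply Rinv_0_lt_compat; lra.
Qed.

(** Nondecreasing [phi n], differentiable only inside the interval, may jump at 0, and the left side
    of the equation may stay below the right one; existence therefore assumes right limits at 0 and
    a point where the right side is reached. The [phi n] may also have plateaus, so uniqueness
    assumes a source of strict growth. *)
Theorem theorem3p1 (alpha beta : R) (phi : nat -> R -> R)
    (halpha : 0 <= alpha) (hbeta : 0 <= beta < 1)
    (hphi : admissible phi)
    (hphi0 :
      Series2 (fun n => phi n 0 / (INR n * (1 + alpha * (INR n - 1))))
      < 1 / (2 * (1 - beta))
        + Series2 (fun n => (-1) ^ (n - 1)
                            / (alpha * INR n ^ 2 + INR n * (1 - alpha)))) :
  (* existence of a root *)
  ((forall n : nat, (2 <= n)%nat ->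
      filterlim (phi n) (at_right 0) (locally (phi n 0))) ->
   (exists r : R, 0 < r < 1 /\
      radius_rhs alpha beta <= radius_lhs alpha beta phi r) ->
   exists rf : R, radius_root alpha beta phi rf)
  /\
  (* uniqueness of the root *)
  (((forall r : R, 0 < r < 1 -> 0 < phi 0%nat r) \/
    (exists n : nat, (2 <= n)%nat /\ strictly_increasing_on_01 (phi n))) ->
   forall r s : R, radius_root alpha beta phi r ->
     radius_root alpha beta phi s -> r = s)
  /\
  (* the inequality up to the root *)
  (forall rf : R, radius_root alpha beta phi rf ->
   forall (f : C -> C) (a b : nat -> C),
     W0H alpha beta f -> has_coefficients f a b ->
     forall r : R, 0 <= r <= rf ->
       ex_series (fun k : nat =>
         (Cmod (a (k + 2)%nat) + Cmod (b (k + 2)%nat)) * phi (k + 2)%nat r) /\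
       bohr_inequality phi f a b r)
  /\
  (* no larger radius works *)
  (forall rf : R, unique (radius_root alpha beta phi) rf ->
   forall R' : R, rf < R' ->
     ~ (forall (f : C -> C) (a b : nat -> C),
          W0H alpha beta f -> has_coefficients f a b ->
          forall r : R, 0 <= r <= R' -> r < 1 -> bohr_inequality phi f a b r)).
Proof.
  assert (Hb : beta < 1) by lra.
  repeat split.
  - intros Hright [b [Hb01 Hle]].
    apply (radius_root_exists alpha beta phi b); trivial.
    now apply radius_lhs_at_0.
  - intros Hst r s [Hr Er] [Hs Es].
    destruct (Rtotal_order r s) as [Hlt|[->|Hlt]]; [|reflexivity|];
      apply (radius_lhs_lt alpha beta phi) in Hlt; trivial; lra.
  - apply (ex_series_bohr alpha beta phi f a b r); trivial.
    destruct H as [Hrf _]. lra.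
  - destruct H as [Hrf Erf]. unfold bohr_inequality.
    apply Rbar_le_trans with (Finite (radius_rhs alpha beta)).
    + simpl. eapply Rle_trans; [apply (ex_series_bohr alpha beta phi f a b r); trivial; lra|].
      rewrite <- Erf. apply radius_lhs_le; trivial; lra.
    + now apply (boundary_dist_ge alpha beta f a b).
  - intros rf [[Hrf Erf] Huniq] R' HR' H.
    (* The midpoint keeps [r] below 1 even if [R'] is not. *)
    set (r := Rmin R' ((rf + 1) / 2)).
    assert (Hr1 : rf < r) by (apply Rmin_glb_lt; lra).
    assert (Hr2 : r <= R') by apply Rmin_l.
    assert (Hr3 : r <= (rf + 1) / 2) by apply Rmin_r.
    assert (Hpos : 0 <= radius_rhs alpha beta)
      by (rewrite <- Erf; apply radius_lhs_nonneg; trivial; lra).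
    specialize (H _ _ _ (extremal_W0H alpha beta halpha hbeta)
      (extremal_has_coefficients alpha beta halpha hbeta) r ltac:(lra) ltac:(lra)).
    unfold bohr_inequality in H. rewrite extremal_bohr_sum in H by assumption.
    assert (Hle := Rbar_le_trans _ _ _ H
      (extremal_boundary_dist_le alpha beta halpha hbeta Hpos)).
    simpl in Hle.
    assert (Hge : radius_lhs alpha beta phi rf <= radius_lhs alpha beta phi r)
      by (apply radius_lhs_le; trivial; lra).
    (* The left side at [r] is at most [radius_rhs] by the extremal function and at least
       [radius_rhs] by monotonicity, so [r] would be a second root. *)
    assert (E : rf = r) by (apply Huniq; split; lra).
    lra.
Qed.
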